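(* Assume $k_{n-1}k_{n+1}=\ell_{n-1}\ell_{n+1}$ for all $n\in\mathbb Z/N\mathbb Z$. Define birational transformations $s_n^i$ ($n\in\mathbb Z/N\mathbb Z$, $-\ell_n+1\le i\le k_n-1$) on the variables $\tau=(\tau_n^i,\tau_n^{-j})$ by $$s_n^0(\tau_n^1)=\frac{{v_n}^{\omega_n}\,\xi_{n+1}\eta_{n-1}+{v_n}^{-1+\omega_n}\,\xi_{n-1}\eta_{n+1}}{\tau_n^{-1}},\qquad s_n^0(\tau_n^{-1})=\frac{{u_n}^{-\omega_n}\,\xi_{n+1}\eta_{n-1}+{u_n}^{1-\omega_n}\,\xi_{n-1}\eta_{n+1}}{\tau_n^1},$$ $$s_n^i(\tau_n^i)=\tau_n^{i+1},\quad s_n^i(\tau_n^{i+1})=\tau_n^i\quad(1\le i\le k_n-1),$$ $$s_n^{-j}(\tau_n^{-j})=\tau_n^{-j-1},\quad s_n^{-j}(\tau_n^{-j-1})=\tau_n^{-j}\quad(1\le j\le\ell_n-1),$$ and $s_n^i(\tau_m^j)=\tau_m^j$ otherwise, where $$\omega_n=\frac{\theta_n^0}{\theta_n^0+\theta_n^\infty},\quad \theta_n^0=k_{n+1}+\ell_{n-1},\quad \theta_n^\infty=k_{n-1}+\ell_{n+1},\quad \xi_n=\prod_{i=1}^{k_n}\tau_n^i,\quad \eta_n=\prod_{j=1}^{\ell_n}\tau_n^{-j}.$$ Then these transformations, together with the action $$s_n^i(a_n^i)=\frac1{a_n^i},\qquad s_n^i(a_n^{i\pm1})=a_n^ia_n^{i\pm1},\qquad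 s_n^0(a_{n\pm1}^0)=a_n^0a_{n\pm1}^0$$ on the multiplicative root variables (all others being fixed), realize the Weyl group $W(T^{\boldsymbol k}_{\boldsymbol\ell})$ over the field $L=\mathbb K(\tau)$ of rational functions in the indeterminates $\tau_n^i,\tau_n^{-j}$; i.e. the induced field automorphisms of $L$ satisfy the fundamental relations of $W(T^{\boldsymbol k}_{\boldsymbol\ell})$.
   Context: Fix $N\ge3$ and sequences ${\boldsymbol k}=(k_1,\dots,k_N)$, ${\boldsymbol\ell}=(\ell_1,\dots,\ell_N)$ of positive integers. Lower indices $n$ are read in $\mathbb Z/N\mathbb Z$. Upper indices on $\tau,a,s$ are labels, not exponents: $\tau_n^{-1}$ is the variable with index $-1$; the variables are $\tau_n^i$ ($1\le i\le k_n$) and $\tau_n^{-j}$ ($1\le j\le\ell_n$). The upper scripts ${}^{\omega_n}$, ${}^{-1+\omega_n}$, ${}^{-\omega_n}$, ${}^{1-\omega_n}$ on $u_n,v_n$ are exponents. The multiplicative root variables $a=(a_n^i)$, $n\in\mathbb Z/N\mathbb Z$, $-\ell_n+1\le i\le k_n-1$, are indeterminates, and $$u_n=\frac{\left(a_n^0\prod_{j=1}^{\ell_n-1}(a_n^{-j})^{1-j/\ell_n}\right)^{\ell_n/(k_n+\ell_n)}}{\left(\prod_{i=1}^{k_n-1}(a_n^i)^{1-i/k_n}\right)^{k_n/(k_n+\ell_n)}},\qquad v_n=\frac{\left(a_n^0\prod_{i=1}^{k_n-1}(a_n^i)^{1-i/k_n}\right)^{k_n/(k_n+\ell_n)}}{\left(\prod_{j=1}^{\ell_n-1}(a_n^{-j})^{1-j/\ell_n}\right)^{\ell_n/(k_n+\ell_n)}}.$$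 $\mathbb K=\mathbb C(a^{1/p})$ is the field generated by the $(a_n^i)^{1/p}$ for a suitable integer $p>0$ such that all fractional powers used lie in $\mathbb K$; the action on $a$ extends multiplicatively to fractional powers. $W(T^{\boldsymbol k}_{\boldsymbol\ell})$ is the Coxeter (Weyl) group with generators $s_n^i$ and relations $(s_n^i)^2=1$, $(ss')^3=1$ for generators at adjacent vertices, $(ss')^2=1$ for distinct generators at non-adjacent vertices of the graph $T^{\boldsymbol k}_{\boldsymbol\ell}$, whose vertices are the $(n,i)$, $n\in\mathbb Z/N\mathbb Z$, $-\ell_n+1\le i\le k_n-1$, and whose edges join $(n,i)$ with $(n,i+1)$, and $(n,0)$ with $(n+1,0)$. *)

(* Defs.v *)
From HB Require Import structures.
From mathcomp Require Import all_boot all_order all_algebra.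
From mathcomp Require Import reals complex mpoly.

Set Implicit Arguments.
Unset Strict Implicit.
Unset Printing Implicit Defensive.

Import Order.TTheory GRing.Theory Num.Theory.
Local Open Scope ring_scope.

Definition zrange (a b : nat) : seq int :=
  [seq i%:Z - a%:Z | i <- iota 0 (a + b).+1].

Lemma mem_zrange (a b : nat) (i : int) :
  (i \in zrange a b) = (- a%:Z <= i <= b%:Z).
Proof.
apply/mapP/idP => [[j]|/andP[ai ib]].
  rewrite mem_iota add0n ltnS => /andP[_ jab] ->.
  by rewrite lerBlDr -PoszD lez_nat addnC jab lerBrDr addNr.
have ia0 : 0 <= i + a%:Z by rewrite -[X in X <= _](addNr a%:Z) lerD2r.
exists (absz (i + a%:Z)); last by rewrite gez0_abs // addrK.
by rewrite mem_iota add0n ltnS /= -lez_nat gez0_abs // PoszD addrC lerD2l.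
Qed.

Section WeylAction.

(* The index n ranges over 'Z_N, which is Z/NZ since N >= 2 wherever these
   definitions are used; k and l are the sequences of positive integers. *)
Variables (R : realType) (N : nat) (k l : 'Z_N -> nat).

Definition nodes : seq ('Z_N * int) :=
  [seq (n, i) | n <- enum 'Z_N, i <- zrange (l n).-1 (k n).-1].

Definition node : finType := seq_sub nodes.

Definition is_node (n : 'Z_N) (i : int) : bool := (n, i) \in nodes.

Definition tau_indices : seq ('Z_N * int) :=
  [seq (n, i) | n <- enum 'Z_N, i <- [seq i <- zrange (l n) (k n) | i != 0]].

Definition tau_index : finType := seq_sub tau_indices.

Definition is_tau (n : 'Z_N) (i : int) : bool := (n, i) \in tau_indices.

Lemma is_nodeE (n : 'Z_N) (i : int) : (0 < k n)%N -> (0 < l n)%N ->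
  is_node n i = (- (l n)%:Z + 1 <= i <= (k n)%:Z - 1).
Proof.
move=> k0 l0; have -> : is_node n i = (i \in zrange (l n).-1 (k n).-1).
  apply/allpairsPdep/idP => [[m [j [_ jm [-> ->]]]] //|ni].
  by exists n, i; rewrite mem_enum.
by rewrite mem_zrange -!subn1 -!subzn // opprB addrC.
Qed.

Lemma is_tauE (n : 'Z_N) (i : int) :
  is_tau n i = (- (l n)%:Z <= i <= (k n)%:Z) && (i != 0).
Proof.
have -> : (- (l n)%:Z <= i <= (k n)%:Z) && (i != 0) =
    (i \in [seq i <- zrange (l n) (k n) | i != 0]).
  by rewrite mem_filter mem_zrange andbC.
apply/allpairsPdep/idP => [[m [j [_ jm [-> ->]]]] //|ni].
by exists n, i; rewrite mem_enum.
Qed.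

Definition arrow (x y : 'Z_N * int) : bool :=
  ((y.1 == x.1) && (y.2 == x.2 + 1)) ||
  [&& x.2 == 0, y.2 == 0 & y.1 == x.1 + 1].

Definition adjacent (x y : 'Z_N * int) : bool := arrow x y || arrow y x.

(* K = C(a^(1/p)) is the field of rational functions over C in the p-th roots
   of the a_n^i, which are independent indeterminates: as a field it does not
   depend on p, which only enters through the identification of the a_n^i. *)
Definition Kfield : fieldType := {fraction {mpoly R[i][#|node|]}}.
Definition Lfield : fieldType :=
  {fraction {mpoly Kfield[#|tau_index|]}}.

Definition CtoK (c : R[i]) : Kfield := tofrac c%:MP.
Definition KtoL (x : Kfield) : Lfield := tofrac x%:MP.

(* The indeterminate (a_n^i)^(1/p); so a_n^i itself is [aroot n i ^+ p].  The
   value 0 at pairs that are not vertices is never used. *)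
Definition aroot (n : 'Z_N) (i : int) : Kfield :=
  if insub (n, i) is Some x then tofrac 'X_(enum_rank (x : node))
  else 0.

Definition tau (n : 'Z_N) (i : int) : Lfield :=
  if insub (n, i) is Some x then tofrac 'X_(enum_rank (x : tau_index))
  else 0.

Definition xi (n : 'Z_N) : Lfield := \prod_(1 <= i < (k n).+1) tau n i%:Z.
Definition eta (n : 'Z_N) : Lfield := \prod_(1 <= j < (l n).+1) tau n (- j%:Z).

(* A product of rational powers of the a_n^i is represented by its vector of
   exponents: products become sums and powers become scalings. *)
Definition expo := {ffun node -> rat^o}.

Definition aexp (n : 'Z_N) (i : int) : expo :=
  [ffun x => (ssval x == (n, i))%:R].

Definition uexp (n : 'Z_N) : expo :=
  ((l n)%:R / (k n + l n)%N%:R : rat) *: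
     (aexp n 0 +
      \sum_(1 <= j < l n) (1 - j%:R / (l n)%:R : rat) *: aexp n (- j%:Z))
  - ((k n)%:R / (k n + l n)%N%:R : rat) *:
     \sum_(1 <= i < k n) (1 - i%:R / (k n)%:R : rat) *: aexp n i%:Z.

Definition vexp (n : 'Z_N) : expo :=
  ((k n)%:R / (k n + l n)%N%:R : rat) *:
     (aexp n 0 +
      \sum_(1 <= i < k n) (1 - i%:R / (k n)%:R : rat) *: aexp n i%:Z)
  - ((l n)%:R / (k n + l n)%N%:R : rat) *:
     \sum_(1 <= j < l n) (1 - j%:R / (l n)%:R : rat) *: aexp n (- j%:Z).

Definition theta0 (n : 'Z_N) : nat := (k (n + 1)%R + l (n - 1)%R)%N.
Definition thetaoo (n : 'Z_N) : nat := (k (n - 1)%R + l (n + 1)%R)%N.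
Definition omega (n : 'Z_N) : rat :=
  (theta0 n)%:R / (theta0 n + thetaoo n)%N%:R.

(* The monomial with exponents e belongs to C(a^(1/p)). *)
Definition p_integral (p : nat) (e : expo) : Prop :=
  forall x, p%:R * e x \is a Num.int.

(* That monomial, as an element of K; meaningful when [p_integral p e]. *)
Definition monomial (p : nat) (e : expo) : Kfield :=
  \prod_(x : node)
    aroot (ssval x).1 (ssval x).2 ^ numq (p%:R * e x).

(* All the fractional powers used in the action lie in K (hence so do u_n and
   v_n, as quotients of these). *)
Definition suitable (p : nat) : Prop :=
  (0 < p)%N /\
  forall n, [/\ p_integral p (omega n *: vexp n),
                p_integral p ((- 1 + omega n) *: vexp n),
                p_integral p (- omega n *: uexp n)
              & p_integral p ((1 - omega n) *: uexp n)].

Lemma suitable_exists : exists p, suitable p.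
Proof.
pose d (e : expo) : nat := (\prod_x `|denq (e x)|)%N.
have d_gt0 e : (0 < d e)%N by apply: prodn_gt0 => x; rewrite absz_gt0 denq_neq0.
have dP e q : (d e %| q)%N -> p_integral q e.
  move=> deq x; have /dvdnP[c ->] : (`|denq (e x)| %| q)%N.
    by apply: dvdn_trans deq; rewrite /d (bigD1 x) //= dvdn_mulr.
  rewrite natrM -mulrA rpredM ?natr_int // pmulrn gtz0_abs ?denq_gt0 //.
  by rewrite mulrC -numqE intr_int.
pose D n := (d (omega n *: vexp n) * (d ((- 1 + omega n) *: vexp n) *
  (d (- omega n *: uexp n) * d ((1 - omega n) *: uexp n))))%N.
exists (\prod_n D n)%N; split=> [|n].
  by apply: prodn_gt0 => n; rewrite !muln_gt0 !d_gt0.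
have Dn : (D n %| \prod_n D n)%N by rewrite (bigD1 n) //= dvdn_mulr.
split; apply: dP; apply: dvdn_trans Dn; rewrite /D.
- exact: dvdn_mulr.
- by apply: dvdn_mull; apply: dvdn_mulr.
- by do 2!apply: dvdn_mull; apply: dvdn_mulr.
- by do 3!apply: dvdn_mull.
Qed.

(* Image of the p-th root of a_m^j under s_n^i: the multiplicative action on
   the a's, extended to fractional powers.  The neighbours of (n, i) in the
   graph are (n, i+1) and (n, i-1) and, if i = 0, (n+1, 0) and (n-1, 0). *)
Definition s_aroot (n : 'Z_N) (i : int) (m : 'Z_N) (j : int) : Kfield :=
  if (m, j) == (n, i) then (aroot n i)^-1
  else if adjacent (n, i) (m, j) then aroot n i * aroot m j
  else aroot m j.

Definition s_tau (p : nat) (n : 'Z_N) (i : int) (m : 'Z_N) (j : int) : Lfield :=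
  if m != n then tau m j
  else if i == 0 then
    if j == 1 then
      (KtoL (monomial p (omega n *: vexp n)) * xi (n + 1) * eta (n - 1) +
       KtoL (monomial p ((- 1 + omega n) *: vexp n)) * xi (n - 1) * eta (n + 1))
      / tau n (- 1)
    else if j == - 1 then
      (KtoL (monomial p (- omega n *: uexp n)) * xi (n + 1) * eta (n - 1) +
       KtoL (monomial p ((1 - omega n) *: uexp n)) * xi (n - 1) * eta (n + 1))
      / tau n 1
    else tau n j
  else if 0 < i then
    if j == i then tau n (i + 1)
    else if j == i + 1 then tau n i
    else tau n j
  else
    if j == i then tau n (i - 1)
    else if j == i - 1 then tau n i
    else tau n j.

(* The field endomorphism of L induced by s_n^i is pinned down by its values on
   C and on the indeterminates. *)
Definition induced_by (p : nat) (n : 'Z_N) (i : int)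
    (f : {rmorphism Lfield -> Lfield}) : Prop :=
  [/\ forall c : R[i], f (KtoL (CtoK c)) = KtoL (CtoK c),
      forall m j, is_node m j -> f (KtoL (aroot m j)) = KtoL (s_aroot n i m j)
    & forall m j, is_tau m j -> f (tau m j) = s_tau p n i m j].

(* The relations of the Coxeter group of the graph; it has no loops or multiple
   edges when N >= 3. *)
Definition weyl_relations (T : Type) (s : 'Z_N -> int -> T -> T) : Prop :=
  (forall n i, is_node n i -> s n i \o s n i =1 id) /\
  (forall n i m j, is_node n i -> is_node m j -> (n, i) != (m, j) ->
     if adjacent (n, i) (m, j)
     then iter 3 (s n i \o s m j) =1 id
     else iter 2 (s n i \o s m j) =1 id).

End WeylAction.

(* Main.v *)
Require Import Defs.
From HB Require Import structures.
From mathcomp Require Import all_boot all_order all_algebra.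
From mathcomp Require Import reals complex mpoly.
From mathcomp Require Import boolp zify ring.

Set Implicit Arguments.
Unset Strict Implicit.
Unset Printing Implicit Defensive.

Import Order.TTheory GRing.Theory Num.Theory.
Local Open Scope ring_scope.

(** The multiplicative roots span the reflection representation of the graph: a
    product of rational powers of the a_n^i is a vector of exponents e, and
    s_x sends e to e + (x,e) a_x, where (x,.) is minus the Cartan form of the
    graph, so on these vectors the Coxeter relations are linear algebra
    ([reflectionK], [reflection_comm], [reflection_braid]).  The exponents of
    v_n are affine along each of the two legs attached to the vertex (n,0) and
    vanish at both ends, so (x,.) kills v_n except at the kinks of this profile,
    namely at the vertices (n,0) and (n,-1), and at the neighbours (n+1,0) and
    (n-1,0) where it takes the value w_n = k_n / (k_n + l_n).  As u_n v_n = a_n^0,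
    this also describes u_n.

    The hypothesis on k and l says exactly that the weights w_(n-1) and w_(n+1)
    add up to 1, and it implies that omega_n = w_(n+1).  The two numerators f_n^+
    and f_n^- of s_n^0 on tau_n^1 and tau_n^(-1) are both of the form
    E_1 X + E_2 Y, where X = xi_(n+1) eta_(n-1), Y = xi_(n-1) eta_(n+1) and the
    E_i are monomials in the roots.  Since s_n^0 exchanges v_n with 1/u_n, it
    exchanges f_n^+ with f_n^-, which makes it an involution.

    The only delicate relation is the braid relation of s_n^0 and s_m^0 with
    m = n+1 or n-1.  It amounts to
      tau_n^1 tau_n^(-1) s_n s_m (f_n^b) = f_n^(-b) s_m (f_n^b)
    ([braid_numer]).  Expanding s_m (f_n^b) gives four terms; half of them contain
    the product of the tau_n^i on one side of column n, which s_n multiplies by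
    f_n^(-b) / (tau_n^1 tau_n^(-1)), and half the product on the other side,
    which s_n multiplies by f_n^b / (tau_n^1 tau_n^(-1)).  In the first half the
    coefficients are fixed by s_n ([braid_exp_fixed]).  In the second half they
    are those of f_n^b times a common monomial fixed by s_n
    ([braid_exp_split], [braid_factor_fixed]), so f_n^b can be factored out; s_n
    turns it into f_n^(-b), and the new factor f_n^b replaces it.  All other
    relations on the tau variables are permutations of variables, or follow
    from the invariance of the numerators ([numer_leg], [numer_leg_fixed],
    [numer_far]).

    A substitution into polynomials extends to the field of fractions only if
    it is injective.  This follows from the same involutivity: if the formulas
    send each variable to a quotient P/Q such that the formulas send P/Q back
    to that variable, then the substitution has a partial inverse
    ([rational_substitution_inj]).  A field morphism on L is determined by its
    values on the constants, the roots and the tau variables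
    ([L_rmorph_ext]), which gives uniqueness and reduces the relations to these
    generators. *)

(** * Morphisms out of a fraction field *)

Lemma fractionP (A : idomainType) (x : {fraction A}) :
  exists a b : A, b != 0 /\ x = tofrac a / tofrac b.
Proof.
elim/quotW: x => r; exists (frac r).1, (frac r).2; split; first exact: denom_ratioP.
have d0 : tofrac (frac r).2 != 0 :> {fraction A} by rewrite tofrac_eq0 denom_ratioP.
apply: (mulIf d0); rewrite divfK //.
unlock tofrac; rewrite -[LHS]FracField.pi_mul /FracField.mulf.
rewrite !numden_Ratio ?oner_eq0 // mulr1.
apply/eqP; rewrite FracField.equivf_def !numden_Ratio ?oner_eq0 ?denom_ratioP //.
by rewrite mulr1 mulrC.
Qed.

Lemma fraction_rmorph_ext (A : idomainType) (F : fieldType)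
    (f g : {rmorphism {fraction A} -> F}) :
  (forall a, f (tofrac a) = g (tofrac a)) -> f =1 g.
Proof.
by move=> fg x; have [a [b [_ ->]]] := fractionP x; rewrite !fmorph_div !fg.
Qed.

Lemma fraction_rmorph_exists (A : idomainType) (F : fieldType)
    (f : {rmorphism A -> F}) : (forall a, f a = 0 -> a = 0) ->
  exists g : {rmorphism {fraction A} -> F}, forall a, g (tofrac a) = f a.
Proof.
move=> f_inj.
have f0 a : a != 0 -> f a != 0 by apply: contra_neq => /f_inj.
have [g gP] : exists g : {fraction A} -> F,
    forall a b, b != 0 -> g (tofrac a / tofrac b) = f a / f b.
  have /choice[g gP] (x : {fraction A}) : exists y : F,
      exists a b, [/\ b != 0, x = tofrac a / tofrac b & y = f a / f b].
    by have [a [b [b0 ->]]] := fractionP x; exists (f a / f b), a, b.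
  exists g => a b b0; have [c [d [d0 ab_cd ->]]] := gP (tofrac a / tofrac b).
  apply/eqP; rewrite eqr_div ?f0 // -!rmorphM; apply/eqP; congr (f _).
  by apply/eqP; rewrite -tofrac_eq !rmorphM -eqr_div ?tofrac_eq0 // ab_cd.
have ga a : g (tofrac a) = f a.
  by have := gP a 1 (oner_neq0 _); rewrite !rmorph1 !divr1.
have gB : zmod_morphism g.
  move=> x y; have [a [b [b0 ->]]] := fractionP x.
  have [c [d [d0 ->]]] := fractionP y.
  rewrite -mulNr -rmorphN addf_div ?tofrac_eq0 // -!rmorphM -rmorphD.
  rewrite !gP ?mulf_neq0 // -mulNr -rmorphN addf_div ?f0 //.
  by rewrite rmorphD !rmorphM.
have gM : monoid_morphism g.
  split=> [|x y]; first by rewrite -tofrac1 ga rmorph1.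
  have [a [b [b0 ->]]] := fractionP x; have [c [d [d0 ->]]] := fractionP y.
  by rewrite mulf_div -!rmorphM !gP ?mulf_neq0 // mulf_div !rmorphM.
pose G : {rmorphism {fraction A} -> F} :=
  HB.pack g (GRing.isZmodMorphism.Build _ _ g gB)
    (GRing.isMonoidMorphism.Build _ _ g gM).
by exists G.
Qed.

Lemma mpoly_rmorph_ext (n : nat) (R0 S : comNzRingType)
    (f g : {rmorphism {mpoly R0[n]} -> S}) :
  (forall c, f c%:MP = g c%:MP) -> (forall i, f 'X_i = g 'X_i) -> f =1 g.
Proof.
move=> fgC fgX; elim/mpolyind => [|c m p _ _ IHp]; first by rewrite !rmorph0.
rewrite !rmorphD IHp; congr (_ + _); rewrite -mul_mpolyC !rmorphM fgC mpolyXE_id.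
by rewrite !rmorph_prod; congr (_ * _); apply: eq_bigr => i _; rewrite !rmorphXn fgX.
Qed.

Section RationalSubstitution.
Variables (F : fieldType) (n : nat).
Local Notation A := {mpoly F[n]}.

(** The polynomials p whose image is a quotient iota P / iota Q with f P / f Q
    equal to iota p form a subring, so it is enough to find such P and Q for the
    constants and the variables.  If f p = 0 then P = 0, hence iota p = 0. *)
Lemma rational_substitution_inj (L : fieldType) (iota f : {rmorphism A -> L}) :
    injective iota ->
    (forall c : F, exists P Q : A, [/\ iota Q != 0, f Q != 0,
       f c%:MP = iota P / iota Q & f P / f Q = iota c%:MP]) ->
    (forall i, exists P Q : A, [/\ iota Q != 0, f Q != 0,
       f 'X_i = iota P / iota Q & f P / f Q = iota 'X_i]) ->
  forall p, f p = 0 -> p = 0.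
Proof.
move=> iota_inj fC fX.
pose good (p : A) := exists P Q : A, [/\ iota Q != 0, f Q != 0,
   f p = iota P / iota Q & f P / f Q = iota p].
have goodM p q : good p -> good q -> good (p * q).
  move=> [P [Q [Q0 fQ0 fp fP]]] [P' [Q' [Q'0 fQ'0 fq fP']]].
  exists (P * P'), (Q * Q'); split.
  - by rewrite rmorphM mulf_neq0.
  - by rewrite rmorphM mulf_neq0.
  - by rewrite !rmorphM fp fq mulf_div.
  - by rewrite !rmorphM -mulf_div fP fP'.
have goodD p q : good p -> good q -> good (p + q).
  move=> [P [Q [Q0 fQ0 fp fP]]] [P' [Q' [Q'0 fQ'0 fq fP']]].
  exists (P * Q' + P' * Q), (Q * Q'); split.
  - by rewrite rmorphM mulf_neq0.
  - by rewrite rmorphM mulf_neq0.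
  - by rewrite !rmorphD !rmorphM fp fq addf_div.
  - by rewrite !rmorphD !rmorphM -addf_div // fP fP'.
have goodp p : good p.
  elim/mpolyind: p => [|c m p _ _ IHp]; first by rewrite -mpolyC0; apply: fC.
  apply: goodD IHp; rewrite -mul_mpolyC; apply: (goodM); first exact: fC.
  rewrite mpolyXE_id; apply: (big_ind good); [by rewrite -mpolyC1; apply: fC|exact: goodM|].
  move=> i _; elim: (m i) => [|e IHe]; first by rewrite expr0 -mpolyC1; apply: fC.
  by rewrite exprS; apply: goodM (IHe); apply: fX.
move=> p fp0; have [P [Q [Q0 fQ0]]] := goodp p.
rewrite fp0 => /esym/eqP; rewrite mulf_eq0 invr_eq0 (negPf Q0) orbF => /eqP P0.
have -> : P = 0 by apply: iota_inj; rewrite P0 rmorph0.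
by rewrite rmorph0 mul0r => /esym p0; apply: iota_inj; rewrite p0 rmorph0.
Qed.

(** The condition on the values h says that the extended map sends h i back to
    the i-th variable; it can be stated before the extension exists because it
    only involves the images of the numerator and of the denominator of h i. *)
Lemma involutive_extension (sigma : {rmorphism F -> F})
    (h : 'I_n -> {fraction A}) :
    involutive sigma ->
    (forall f : {rmorphism A -> {fraction A}},
       (forall c, f c%:MP = tofrac (sigma c)%:MP) -> (forall i, f 'X_i = h i) ->
     forall i, exists P Q : A, [/\ tofrac Q != 0, f Q != 0,
       h i = tofrac P / tofrac Q & f P / f Q = tofrac 'X_i]) ->
  exists g : {rmorphism {fraction A} -> {fraction A}},
     (forall c, g (tofrac c%:MP) = tofrac (sigma c)%:MP) /\
     (forall i, g (tofrac 'X_i) = h i).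
Proof.
move=> sK hP.
pose iota : {rmorphism F -> {fraction A}} := @tofrac A \o @mpolyC n F \o sigma.
pose f : {rmorphism A -> {fraction A}} := mmap iota h.
have fC c : f c%:MP = tofrac (sigma c)%:MP by rewrite /f /= mmapC.
have fX i : f 'X_i = h i by rewrite /f /= mmapX mmap1U.
have tofrac_inj : injective (@tofrac A).
  by move=> x y /eqP; rewrite tofrac_eq => /eqP.
move: f fC fX => f fC fX; have {}hP := hP f fC fX.
have f_inj : forall p, f p = 0 -> p = 0.
  apply: (rational_substitution_inj tofrac_inj) => [c|i].
    exists (sigma c)%:MP, 1; rewrite (rmorph1 f) (rmorph1 (@tofrac A)) !divr1.
    by rewrite !fC sK; split=> //; apply: oner_neq0.
  by rewrite fX.
have [g gP] := fraction_rmorph_exists f_inj.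
exists g; split=> [c|i]; first by rewrite gP fC.
by rewrite gP fX.
Qed.

End RationalSubstitution.

Section PolynomialSubstitutions.
Variables (F : fieldType) (n : nat).
Local Notation A := {mpoly F[n]}.

Lemma mpolyX_neq0 (i : 'I_n) : 'X_i != 0 :> A.
Proof.
apply/eqP => /(congr1 (meval (fun=> 1))); rewrite mevalXU meval0 => /eqP.
by rewrite oner_eq0.
Qed.

Lemma tofracX_neq0 (i : 'I_n) : tofrac ('X_i : A) != 0.
Proof. by rewrite tofrac_eq0 mpolyX_neq0. Qed.

(** The action of a simple reflection on the roots: x is the vertex of the
    reflection and nb the set of its neighbours. *)
Lemma reflection_substitution (x : 'I_n) (nb : pred 'I_n) : ~~ nb x ->
  exists g : {rmorphism {fraction A} -> {fraction A}},
     (forall c, g (tofrac c%:MP) = tofrac c%:MP) /\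
     (forall i, g (tofrac 'X_i) =
        if i == x then (tofrac 'X_x)^-1
        else if nb i then tofrac 'X_x * tofrac 'X_i else tofrac 'X_i).
Proof.
move=> /negPf nbx.
pose h i : {fraction A} := if i == x then (tofrac 'X_x)^-1
  else if nb i then tofrac 'X_x * tofrac 'X_i else tofrac 'X_i.
have hx : h x = (tofrac 'X_x)^-1 by rewrite /h eqxx.
have h_nb i : i != x -> nb i -> h i = tofrac 'X_x * tofrac 'X_i.
  by move=> /negPf ix nbi; rewrite /h ix nbi.
have h_far i : i != x -> ~~ nb i -> h i = tofrac 'X_i.
  by move=> /negPf ix /negPf nbi; rewrite /h ix nbi.
suff [g [gC gX]] : exists g : {rmorphism {fraction A} -> {fraction A}},
     (forall c, g (tofrac c%:MP) = tofrac c%:MP) /\ (forall i, g (tofrac 'X_i) = h i).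
  by exists g; split=> // i; rewrite gX.
move: h hx h_nb h_far => h hx h_nb h_far.
have := @involutive_extension F n idfun h (fun c => erefl); apply.
move=> f fC fX i; have x0 := tofracX_neq0 x.
have one_neq0 : tofrac (1 : A) != 0 by rewrite tofrac1 oner_neq0.
have [->|ix] := eqVneq i x.
  exists 1, 'X_x; split; first exact: x0.
  - by rewrite fX hx; apply: invr_neq0; exact: x0.
  - by rewrite hx tofrac1 div1r.
  - by rewrite fX hx rmorph1 invrK mul1r.
have f1 : f 1 != 0 by rewrite rmorph1 oner_neq0.
have [nbi|nbi] := boolP (nb i); last first.
  exists 'X_i, 1; split; [exact: one_neq0 | exact: f1 | |].
  - by rewrite h_far // tofrac1 divr1.
  - by rewrite fX h_far // rmorph1 divr1.
exists ('X_x * 'X_i), 1; split; [exact: one_neq0 | exact: f1 | |].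
- by rewrite h_nb // tofrac1 divr1 [RHS]tofracM.
- rewrite (rmorphM f) !fX hx (h_nb i ix nbi) (rmorph1 f) divr1.
  exact: mulKf x0 _.
Qed.

Variable sigma : {rmorphism F -> F}.
Hypothesis sigmaK : involutive sigma.

Lemma relabelling_substitution (pi : 'I_n -> 'I_n) : involutive pi ->
  exists g : {rmorphism {fraction A} -> {fraction A}},
     (forall c, g (tofrac c%:MP) = tofrac (sigma c)%:MP) /\
     (forall i, g (tofrac 'X_i) = tofrac 'X_(pi i)).
Proof.
move=> piK.
apply: (@involutive_extension F n sigma (fun i => tofrac 'X_(pi i))) => // f fC fX i.
exists 'X_(pi i), 1; rewrite (rmorph1 f) tofrac1 !divr1 fX piK.
by split=> //; apply: oner_neq0.
Qed.

(** The shape of s_n^0 on the tau variables: the two variables x true and x false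
    are replaced by quotients whose denominator is the other one and whose
    numerators P true and P false are exchanged by the substitution. *)
Lemma exchange_substitution (x : bool -> 'I_n) (P : bool -> A) :
    x true != x false -> (forall b, P b != 0) ->
    (forall f : {rmorphism A -> {fraction A}},
       (forall c, f c%:MP = tofrac (sigma c)%:MP) ->
       (forall i, (forall b, i != x b) -> f 'X_i = tofrac 'X_i) ->
     forall b, f (P b) = tofrac (P (~~ b))) ->
  exists g : {rmorphism {fraction A} -> {fraction A}},
    [/\ forall c, g (tofrac c%:MP) = tofrac (sigma c)%:MP,
        forall b, g (tofrac 'X_(x b)) = tofrac (P b) / tofrac 'X_(x (~~ b))
      & forall i, (forall b, i != x b) -> g (tofrac 'X_i) = tofrac 'X_i].
Proof.
move=> x_neq P0 fP.
pose h i : {fraction A} := if i == x true then tofrac (P true) / tofrac 'X_(x false)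
  else if i == x false then tofrac (P false) / tofrac 'X_(x true) else tofrac 'X_i.
have hx b : h (x b) = tofrac (P b) / tofrac 'X_(x (~~ b)).
  by rewrite /h; case: b; rewrite eqxx // eq_sym (negPf x_neq).
have h_other i : (forall b, i != x b) -> h i = tofrac 'X_i.
  by move=> ix; rewrite /h !(negPf (ix _)).
have hx0 b : h (x b) != 0.
  by rewrite hx mulf_neq0 ?invr_neq0 ?tofracX_neq0 // tofrac_eq0.
move: h hx h_other hx0 => h hx h_other hx0.
have [|g [gC gX]] := @involutive_extension F n sigma h sigmaK; last first.
  exists g; split; [exact: gC | by move=> b; rewrite gX; apply: hx | ].
  by move=> i /h_other hi; rewrite gX; exact: hi.
move=> f fC fX i.
have {}fP b : f (P b) = tofrac (P (~~ b)).
  by apply: fP => // j jx; rewrite fX h_other.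
have [[b ->]|ix] : (exists b, i = x b) \/ (forall b, i != x b).
- have [->|i1] := eqVneq i (x true); first by left; exists true.
  have [->|i2] := eqVneq i (x false); first by left; exists false.
  by right; case.
- exists (P b), 'X_(x (~~ b)); split; first exact: tofracX_neq0.
  + by rewrite fX hx0.
  + exact: hx.
  + rewrite fX hx fP negbK invf_div mulrCA divff ?mulr1 //.
    by rewrite tofrac_eq0.
exists 'X_i, 1; rewrite (rmorph1 f) tofrac1 !divr1 fX h_other //.
by split=> //; apply: oner_neq0.
Qed.

End PolynomialSubstitutions.

(** * The reflection representation on exponent vectors *)

Section CyclicNeighbours.
Variables (N : nat) (N3 : (3 <= N)%N).
Implicit Types n m : 'Z_N.

Lemma Zp_neq_succ n : (n + 1 == n) = false.
Proof.
rewrite -subr_eq0 addrAC subrr add0r; apply/negP => /eqP/(congr1 val) /=.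
by rewrite Zp_cast ?modn_small //; lia.
Qed.

Lemma Zp_neq_pred n : (n - 1 == n) = false.
Proof. by rewrite -[X in _ == X](subrK 1) eq_sym Zp_neq_succ. Qed.

Lemma Zp_succ_neq_pred n : (n + 1 == n - 1) = false.
Proof.
rewrite -subr_eq0 opprB addrC addrA subrK -[1 + 1](natrD _ 1 1).
apply/negP => /eqP/(congr1 (@nat_of_ord _)).
by rewrite val_Zp_nat ?modn_small //; lia.
Qed.

(** Minus the Cartan matrix of the graph: s_x multiplies the root at y by the
    root at x to the power cartan x y. *)
Definition cartan (x y : 'Z_N * int) : int :=
  if y == x then - 2 else (adjacent x y)%:R.

(** As N >= 3, the at most four neighbours of a vertex are distinct, so cartan is
    a sum of indicator functions: a second difference along the leg, and the
    terms of the cycle. *)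
Lemma cartanE n i (y : 'Z_N * int) :
  cartan (n, i) y = (y == (n, i + 1))%:R + (y == (n, i - 1))%:R
    - 2 * (y == (n, i))%:R
    + (i == 0)%:R * ((y == (n + 1, 0))%:R + (y == (n - 1, 0))%:R).
Proof.
case: y => m j; rewrite /cartan /adjacent /arrow !xpair_eqE /=.
rewrite [n == m]eq_sym [n == m + 1]eq_sym -[m + 1 == n](inj_eq (addIr (- 1))) addrK.
have e1 : (i == j + 1) = (j == i - 1) by apply/eqP/eqP; lia.
rewrite e1 !(andbC (m == _)).
have [-> |mn] := eqVneq m n.
  rewrite ![n == n + _]eq_sym Zp_neq_succ Zp_neq_pred /= !andbF !andbT !orbF.
  case: (eqVneq j i) => ?; case: (eqVneq j (i + 1)) => ?;
    case: (eqVneq j (i - 1)) => ? //=; lia.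
rewrite !andbF /= andbC; have [-> |ms] := eqVneq m (n + 1).
  by rewrite Zp_succ_neq_pred !andbF; case: (i == 0); case: (j == 0).
by rewrite !andbF /=; case: (m == _); case: (i == 0); case: (j == 0).
Qed.

End CyclicNeighbours.

Lemma cartanC N (x y : 'Z_N * int) : cartan x y = cartan y x.
Proof. by rewrite /cartan eq_sym /adjacent orbC. Qed.

Section Exponents.
Variables (N : nat) (k l : 'Z_N -> nat).
Hypotheses (k_gt0 : forall n, (0 < k n)%N) (l_gt0 : forall n, (0 < l n)%N).
Implicit Types (n m : 'Z_N) (e : expo k l) (x y : 'Z_N * int).

Lemma expoDE e1 e2 (z : node k l) : (e1 + e2) z = (e1 z : rat) + e2 z.
Proof. by rewrite ffunE. Qed.

Lemma expoNE e (z : node k l) : (- e) z = - (e z : rat).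
Proof. by rewrite ffunE. Qed.

Lemma expoZE (c : rat) e (z : node k l) : (c *: e) z = c * (e z : rat).
Proof. by rewrite ffunE. Qed.

Definition expoE := (expoDE, expoNE, expoZE).

(** Extending exponent vectors by 0 beyond the ends of the legs avoids special
    cases for the end vertices in second differences. *)
Definition coord e x : rat := if insub x is Some y then e y else 0.

Lemma coordD e1 e2 x : coord (e1 + e2) x = coord e1 x + coord e2 x.
Proof. by rewrite /coord; case: insub => [y|]; rewrite ?ffunE ?addr0. Qed.

Lemma coordZ (c : rat) e x : coord (c *: e) x = c * coord e x.
Proof. by rewrite /coord; case: insub => [y|]; rewrite ?ffunE ?mulr0. Qed.

Lemma coordN e x : coord (- e) x = - coord e x.
Proof. by rewrite /coord; case: insub => [y|]; rewrite ?ffunE ?oppr0. Qed.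

Lemma coord_sum (I : Type) (r : seq I) (F : I -> expo k l) x :
  coord (\sum_(i <- r) F i) x = \sum_(i <- r) coord (F i) x.
Proof.
elim: r => [|i r IHr]; last by rewrite !big_cons coordD IHr.
by rewrite !big_nil /coord; case: insub => [y|]; rewrite ?ffunE.
Qed.

Lemma coord_aexp n (i : int) m (j : int) :
  coord (aexp k l n i) (m, j) = (is_node k l m j && ((m, j) == (n, i)))%:R.
Proof. by rewrite /coord /is_node; case: insubP => [y -> <-|/negPf->] //; rewrite ffunE. Qed.

Lemma is_node_ltE n (i : int) : is_node k l n i = (- (l n)%:Z < i < (k n)%:Z).
Proof. by rewrite is_nodeE //; apply/andP/andP => [] []; lia. Qed.

Lemma node0 n : is_node k l n 0.
Proof. by rewrite is_node_ltE //; have := k_gt0 n; have := l_gt0 n; lia. Qed.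

Definition weight n : rat := (k n)%:R / (k n + l n)%N%:R.

Lemma kl_neq0 n : (k n)%:R + (l n)%:R != 0 :> rat.
Proof. by rewrite -natrD pnatr_eq0 addn_eq0 negb_and -lt0n k_gt0. Qed.

Lemma uexpE n : uexp k l n = aexp k l n 0 - vexp k l n.
Proof.
rewrite /uexp /vexp; set A := \sum_(1 <= j < l n) _; set B := \sum_(1 <= j < k n) _.
by apply/ffunP => x; rewrite !expoE /=; field; exact: kl_neq0.
Qed.

(** The hypothesis F c = 0 lets the selected index a be the excluded bound c: the
    exponents of v_n vanish there. *)
Lemma sum_pick (F : nat -> rat) (P : nat -> bool) (a c : nat) :
    F c = 0 -> (1 <= a <= c)%N ->
    (forall j : nat, (1 <= j < c)%N -> P j = (j == a)) ->
  \sum_(1 <= j < c) F j * (P j)%:R = F a.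
Proof.
move=> Fc ac Pa; rewrite big_nat_cond.
rewrite (eq_bigr (fun j => if j == a then F j else 0)) => [|j]; last first.
  by rewrite andbT => /Pa->; case: eqP; rewrite ?mulr1 ?mulr0.
rewrite -big_nat_cond -big_mkcond big_nat1_eq; case: ifP => // ca.
by have -> : a = c by lia.
Qed.

Lemma sum_pick0 (F : nat -> rat) (P : nat -> bool) (c : nat) :
  (forall j : nat, (1 <= j < c)%N -> P j = false) -> \sum_(1 <= j < c) F j * (P j)%:R = 0.
Proof. by move=> P0; rewrite big_nat big1 // => j /P0->; rewrite mulr0. Qed.

(** Along the column m = n the exponents of v_n are affine on [0, k_n] and on
    [-l_n, -1], and the formulas give the right value 0 at the indices k_n and
    -l_n, which are not vertices. *)
Lemma coord_vexp n m (i : int) : - (l m)%:Z <= i <= (k m)%:Z ->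
  coord (vexp k l n) (m, i) = (m == n)%:R *
    (if 0 <= i then (k m)%:R - i%:~R else - ((l m)%:R + i%:~R)) / (k m + l m)%N%:R.
Proof.
move=> iP; rewrite /vexp coordD coordN !coordZ coordD !coord_sum.
under eq_bigr do rewrite coordZ coord_aexp is_node_ltE.
under [\sum_(1 <= j < l n) _]eq_bigr do rewrite coordZ coord_aexp is_node_ltE.
rewrite coord_aexp is_node_ltE.
have [mn|mn] := eqVneq m n; last first.
  rewrite xpair_eqE (negPf mn) andbF !mul0r add0r.
  by rewrite !sum_pick0 ?mulr0 ?subr0 // => j _; rewrite xpair_eqE (negPf mn) andbF.
subst m; have k0 : (k n)%:R != 0 :> rat by rewrite pnatr_eq0 -lt0n.
have l0 : (l n)%:R != 0 :> rat by rewrite pnatr_eq0 -lt0n.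
have kl0 := kl_neq0 n.
have := k_gt0 n; have := l_gt0 n.
case: (ltgtP i 0) iP => [i0|i0|->] iP lP kP; rewrite xpair_eqE eqxx /=.
- have [a ia aP] : exists2 a : nat, i = - a%:Z & (1 <= a <= l n)%N.
    by exists `|i|%N; lia.
  rewrite [X in _ * (_ + X)]sum_pick0 => [|j jP]; last by rewrite xpair_eqE eqxx; lia.
  rewrite (sum_pick (a := a)) ?divff ?subrr // => [|j jP]; last first.
    by rewrite xpair_eqE eqxx; lia.
  rewrite ia lt_eqF ?andbF; last by lia.
  by rewrite rmorphN /=; field; rewrite kl0.
- have [a ia aP] : exists2 a : nat, i = a%:Z & (1 <= a <= k n)%N.
    by exists `|i|%N; lia.
  rewrite [X in _ - _ * X]sum_pick0 => [|j jP]; last by rewrite xpair_eqE eqxx; lia.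
  rewrite (sum_pick (a := a)) ?divff ?subrr // => [|j jP]; last first.
    by rewrite xpair_eqE eqxx; lia.
  rewrite ia gt_eqF ?andbF; last by lia.
  by rewrite /=; field; rewrite k0 kl0.
rewrite !sum_pick0 => [|j jP|j jP]; try by rewrite xpair_eqE eqxx; lia.
have -> : - (l n)%:Z < 0 < (k n)%:Z by lia.
by rewrite /=; field.
Qed.

Definition pairing x e : rat := \sum_(y : node k l) (cartan x (ssval y))%:~R * e y.

Definition reflection x e : expo k l := e + pairing x e *: aexp k l x.1 x.2.

Lemma pairingD x e1 e2 : pairing x (e1 + e2) = pairing x e1 + pairing x e2.
Proof. by rewrite -big_split; apply: eq_bigr => y _; rewrite ffunE mulrDr. Qed.

Lemma pairingZ x (c : rat) e : pairing x (c *: e) = c * pairing x e.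
Proof. by rewrite mulr_sumr; apply: eq_bigr => y _; rewrite ffunE mulrCA. Qed.

Lemma sum_coord e x : \sum_(y : node k l) (ssval y == x)%:R * e y = coord e x.
Proof.
rewrite /coord; case: insubP => [z _ zx|xN].
  rewrite (bigD1 z) //= big1 => [|y /negPf yz]; last first.
    by rewrite -zx (inj_eq val_inj) yz mul0r.
  by rewrite zx eqxx mul1r addr0.
rewrite big1 // => y _; case: eqP => [yx|_]; last by rewrite mul0r.
by rewrite -yx (valP y) in xN.
Qed.

Lemma pairing_aexp x n (i : int) :
  is_node k l n i -> pairing x (aexp k l n i) = (cartan x (n, i))%:~R.
Proof.
move=> ni; rewrite /pairing -[n]/((n, i).1); pose z : node k l := SeqSub ni.
rewrite (bigD1 z) //= ffunE eqxx mulr1 big1 ?addr0 // => y /negPf yz.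
by rewrite ffunE -[(n, i)]/(val z) (inj_eq val_inj) yz mulr0.
Qed.

Hypothesis N3 : (3 <= N)%N.

Lemma pairingE n (i : int) e :
  pairing (n, i) e = coord e (n, i + 1) + coord e (n, i - 1) - 2 * coord e (n, i)
    + (i == 0)%:R * (coord e (n + 1, 0) + coord e (n - 1, 0)).
Proof.
rewrite -!sum_coord mulr_sumr -sumrN -!big_split mulr_sumr -!big_split /=.
apply: eq_bigr => y _; rewrite cartanE //.
by rewrite !(rmorphD, rmorphB, rmorphM, rmorph_nat) /=; ring.
Qed.

(** A second difference of an affine function is zero; what remains comes from
    the jump of the profile between -1 and 0, and from the edges of the cycle. *)
Lemma pairing_vexp n (i : int) m : is_node k l n i ->
  pairing (n, i) (vexp k l m) =
    if i == 0 then
      if n == m then -1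
      else if (m == n + 1) || (m == n - 1) then weight m else 0
    else ((n == m) && (i == -1))%:R.
Proof.
rewrite is_node_ltE => ni; rewrite pairingE !coord_vexp; try by lia.
have kl0 := kl_neq0 n.
have [-> {i ni}|i0] := eqVneq i 0.
  rewrite mul1r !add0r /= !subr0.
  have [<-|nm] := eqVneq n m.
    rewrite Zp_neq_succ // Zp_neq_pred // !mul0r !addr0 !mul1r.
    by field.
  rewrite !mul0r mulr0 addr0 subr0 add0r.
  rewrite [m == n + 1]eq_sym [m == n - 1]eq_sym.
  have [<-|_] := eqVneq (n + 1) m.
    by rewrite eq_sym Zp_succ_neq_pred // !mul0r addr0 mul1r.
  have [<-|_] := eqVneq (n - 1) m; first by rewrite !mul0r add0r mul1r.
  by rewrite !mul0r addr0.
rewrite mul0r addr0; have [_|_] := eqVneq n m; last by rewrite !mul0r /=; ring.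
have [-> |i1] := eqVneq i (-1) => /=; first by field.
have -> : (0 <= i + 1) = (0 <= i) by lia.
have -> : (0 <= i - 1) = (0 <= i) by lia.
rewrite rmorphB rmorphD /=.
by case: ifP => _; field.
Qed.

End Exponents.

(** * Exponents of the numerators of the central reflections *)

Section Weights.
Variables (N : nat) (k l : 'Z_N -> nat).
Hypothesis k_gt0 : forall n, (0 < k n)%N.
Implicit Types n : 'Z_N.

Definition shift (d : bool) n : 'Z_N := if d then n + 1 else n - 1.
Definition signb (b : bool) : int := if b then 1 else -1.

Definition uvexp b n : expo k l := if b then vexp k l n else uexp k l n.
Definition uvweight (b : bool) n : rat := if b then weight k l n else 1 - weight k l n.
(** The exponents of the four coefficients of s_n^0 on tau_n^1 (b true) and
    tau_n^(-1) (b false); c tells whether the coefficient multiplies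
    xi_(n+1) eta_(n-1) or xi_(n-1) eta_(n+1).  Encoding both choices by signs
    treats the four cases at once; [exchange_exp_omega] recovers the powers of
    u_n and v_n by omega_n. *)
Definition exchange_exp (c b : bool) n : expo k l :=
  ((signb c * signb b)%:~R * weight k l (shift c n)) *: uvexp b n.

Lemma shiftK d n : shift (~~ d) (shift d n) = n.
Proof. by case: d; rewrite /= ?addrK ?subrK. Qed.

Hypothesis balanced :
  forall n, (k (n - 1)%R * k (n + 1)%R = l (n - 1)%R * l (n + 1)%R)%N.

(** Writing r for k_(n+1) / l_(n+1) = l_(n-1) / k_(n-1), the numerator theta_n^0 is
    r times theta_n^oo, so omega_n = r / (1 + r). *)
Lemma omegaE n : omega k l n = weight k l (n + 1).
Proof.
have b : (k (n - 1)%R)%:R * (k (n + 1)%R)%:R = (l (n - 1)%R)%:R * (l (n + 1)%R)%:R :> rat.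
  by rewrite -!natrM balanced.
have d0 : (k (n + 1)%R)%:R + (l (n - 1)%R)%:R + ((k (n - 1)%R)%:R + (l (n + 1)%R)%:R) != 0 :> rat.
  by rewrite -!natrD pnatr_eq0; have := k_gt0 (n + 1); lia.
rewrite /omega /weight /theta0 /thetaoo; apply/eqP.
rewrite eqr_div ?natrD ?(kl_neq0 l k_gt0) //; apply/eqP.
by rewrite mulrDl !mulrDr -b; ring.
Qed.

Lemma weight_opp n : weight k l (n - 1) = 1 - weight k l (n + 1).
Proof.
have b : (k (n - 1)%R)%:R * (k (n + 1)%R)%:R = (l (n - 1)%R)%:R * (l (n + 1)%R)%:R :> rat.
  by rewrite -!natrM balanced.
apply/eqP; rewrite /weight !natrD eq_sym subr_eq addf_div ?(kl_neq0 l k_gt0) // eq_sym.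
apply/eqP/(canLR (mulfK _)); first by rewrite mulf_neq0 ?(kl_neq0 l k_gt0).
by rewrite mul1r [RHS]mulrDl !mulrDr -b; ring.
Qed.

Lemma exchange_exp_omega n :
  [/\ omega k l n *: vexp k l n = exchange_exp true true n,
      (- 1 + omega k l n) *: vexp k l n = exchange_exp false true n,
      - omega k l n *: uexp k l n = exchange_exp true false n
    & (1 - omega k l n) *: uexp k l n = exchange_exp false false n].
Proof.
rewrite omegaE /exchange_exp /= weight_opp.
by split; congr (_ *: _); ring.
Qed.

Lemma p_integral_exchange_exp p : suitable k l p -> forall c b n, p_integral p (exchange_exp c b n).
Proof.
move=> p_suitable c b n; have [_ /(_ n)[? ? ? ?]] := p_suitable.
have [v1 v2 u1 u2] := exchange_exp_omega n.
by case: c b => [] []; rewrite -?v1 -?v2 -?u1 -?u2.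
Qed.

Lemma weight_shift c d n :
  weight k l (shift c n) =
  if c == d then weight k l (shift d n) else 1 - weight k l (shift d n).
Proof.
have w : weight k l (n + 1) = 1 - weight k l (n - 1) by rewrite weight_opp subKr.
by case: c d => [] []; [reflexivity | exact: w | exact: weight_opp | reflexivity].
Qed.

Lemma weight_shift2 d n : weight k l (shift d (shift d n)) = 1 - weight k l n.
Proof. by rewrite (weight_shift d (~~ d)) shiftK; case: d. Qed.

End Weights.

(** * Coxeter relations on exponent vectors *)

Section CoxeterExponents.
Variables (N : nat) (N3 : (3 <= N)%N) (k l : 'Z_N -> nat).
Hypotheses (k_gt0 : forall n, (0 < k n)%N) (l_gt0 : forall n, (0 < l n)%N).
Implicit Types (n m : 'Z_N) (e : expo k l) (x y : 'Z_N * int).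
Local Notation refl := (@reflection N k l).
Local Notation a := (aexp k l).
Local Notation shift := (@shift N).
Local Notation uvexp := (uvexp k l).
Local Notation uvweight := (uvweight k l).
Local Notation exchange_exp := (exchange_exp k l).

Let uexpE := uexpE l k_gt0.

Lemma reflection_fixed x e : pairing x e = 0 -> refl x e = e.
Proof. by rewrite /reflection => ->; rewrite scale0r addr0. Qed.

Lemma reflectionK x e : is_node k l x.1 x.2 -> refl x (refl x e) = e.
Proof.
case: x => n i /= ni; rewrite {1}/reflection pairingD pairingZ pairing_aexp //.
rewrite /reflection /cartan eqxx -addrA -scalerDl.
by rewrite [X in X *: _](_ : _ = 0) ?scale0r ?addr0 //; ring.
Qed.

Lemma cartan_neq x y : x != y -> cartan x y = (adjacent x y)%:R.
Proof. by rewrite /cartan eq_sym => /negPf->. Qed.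

Lemma reflection_braid x y e :
    is_node k l x.1 x.2 -> is_node k l y.1 y.2 -> x != y -> adjacent x y ->
  refl x (refl y (refl x e)) = refl y (refl x (refl y e)).
Proof.
case: x y => n i [m j] /= ni mj xy adj.
have cxy : cartan (n, i) (m, j) = 1 by rewrite cartan_neq // adj.
have cyx : cartan (m, j) (n, i) = 1 by rewrite cartanC.
have cxx x : cartan x x = -2 by rewrite /cartan eqxx.
rewrite /reflection !(pairingD, pairingZ, pairing_aexp) // cxy cyx !cxx.
by apply/ffunP => z; rewrite !expoE /=; ring.
Qed.

Lemma reflection_comm x y e :
    is_node k l x.1 x.2 -> is_node k l y.1 y.2 -> x != y -> ~~ adjacent x y ->
  refl x (refl y e) = refl y (refl x e).
Proof.
case: x y => n i [m j] /= ni mj xy /negPf adj.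
have cxy : cartan (n, i) (m, j) = 0 by rewrite cartan_neq // adj.
have cyx : cartan (m, j) (n, i) = 0 by rewrite cartanC.
rewrite /reflection !(pairingD, pairingZ, pairing_aexp) // cxy cyx.
by rewrite !mulr0 !addr0 addrAC.
Qed.

Section Integrality.
Variable p : nat.

Lemma p_integralD e1 e2 :
  p_integral p e1 -> p_integral p e2 -> p_integral p (e1 + e2).
Proof. by move=> pe1 pe2 x; rewrite ffunE mulrDr rpredD. Qed.

Lemma p_integralB e1 e2 :
  p_integral p e1 -> p_integral p e2 -> p_integral p (e1 - e2).
Proof. by move=> p1 p2; apply: p_integralD => // x; rewrite ffunE mulrN rpredN. Qed.

Lemma p_integral_reflection x e : p_integral p e -> p_integral p (refl x e).
Proof.
move=> pe; apply: p_integralD => // y; rewrite !ffunE /= mulrA.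
apply: rpredM; last by rewrite natr_int.
rewrite mulr_sumr rpred_sum // => z _.
by rewrite mulrCA rpredM // intr_int.
Qed.

End Integrality.

Lemma shift_neq d n : (shift d n == n) = false.
Proof. by case: d; [exact: Zp_neq_succ | exact: Zp_neq_pred]. Qed.

Lemma adjacent0 n m : adjacent (n, 0) (m, 0) = (m == n + 1) || (m == n - 1).
Proof.
rewrite /adjacent /arrow /= !add0r !andbF /=; congr (_ || _).
by rewrite -[n == _](inj_eq (addIr (- 1))) addrK eq_sym.
Qed.

Lemma adjacent_shift d n : adjacent (n, 0) (shift d n, 0).
Proof. by rewrite adjacent0; case: d; rewrite eqxx ?orbT. Qed.

Lemma pairing_uvexp_self b n : pairing (n, 0) (uvexp b n) = -1.
Proof.
have v : pairing (n, 0) (vexp k l n) = -1 by rewrite pairing_vexp ?node0 ?eqxx.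
case: b => //=; rewrite uexpE -scaleN1r pairingD pairingZ v pairing_aexp ?node0 //.
by rewrite /cartan eqxx.
Qed.

Lemma pairing_uvexp_shift b d n : pairing (shift d n, 0) (uvexp b n) = uvweight b n.
Proof.
have v : pairing (shift d n, 0) (vexp k l n) = weight k l n.
  rewrite pairing_vexp ?node0 //= shift_neq.
  by case: d; rewrite /= ?addrK ?subrK eqxx ?orbT.
case: b => //=; rewrite uexpE -scaleN1r pairingD pairingZ v pairing_aexp ?node0 //.
rewrite cartanC cartan_neq ?adjacent_shift; first by rewrite mulN1r.
by rewrite xpair_eqE andbT eq_sym shift_neq.
Qed.

Lemma pairing_uvexp_far b n m : m != n -> ~~ adjacent (m, 0) (n, 0) ->
  pairing (m, 0) (uvexp b n) = 0.
Proof.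
move=> mn far.
have v : pairing (m, 0) (vexp k l n) = 0.
  by rewrite pairing_vexp ?node0 //= (negPf mn) -adjacent0 (negPf far).
case: b => //=; rewrite uexpE -scaleN1r pairingD pairingZ v pairing_aexp ?node0 //.
by rewrite cartan_neq ?(negPf far) // xpair_eqE negb_and mn.
Qed.

Lemma pairing_uvexp_leg b n m (i : int) : is_node k l m i -> i != 0 ->
  pairing (m, i) (uvexp b n) = ((m == n) && (i == - signb b))%:R.
Proof.
move=> mi i0.
have v : pairing (m, i) (vexp k l n) = ((m == n) && (i == -1))%:R.
  by rewrite pairing_vexp // (negPf i0).
case: b => //=; rewrite uexpE -scaleN1r pairingD pairingZ v pairing_aexp ?node0 //.
rewrite cartan_neq ?xpair_eqE ?(negPf i0) ?andbF // /adjacent /arrow /=.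
rewrite ?(negPf i0) ?andbF ?orbF ?(eq_sym n) opprK.
case: (m == n) => //=; have -> : (i == 0 + 1) = (i == 1) by [].
have -> : (0 == i + 1) = (i == -1) by lia.
by case: (eqVneq i 1) => [->|_] //; case: (eqVneq i (-1)).
Qed.

Hypothesis balanced :
  forall n, (k (n - 1)%R * k (n + 1)%R = l (n - 1)%R * l (n + 1)%R)%N.

(** With m = shift d n: exponents of the coefficients in the expansion of s_m^0
    applied to the numerator b at n.  The index c selects a term of that
    numerator.  Its cross product contains the variables of column m on the side
    c == d, so s_m^0 introduces the numerator c == d at m, and c' selects one of
    its terms. *)
Definition braid_exp b d c' c n : expo k l :=
  refl (shift d n, 0) (exchange_exp c b n) + exchange_exp c' (c == d) (shift d n).

(** The reflection s_n^0 exchanges v_n with the inverse of u_n. *)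
Lemma exchange_exp_flip c b n : refl (n, 0) (exchange_exp c b n) = exchange_exp c (~~ b) n.
Proof.
rewrite /reflection /exchange_exp pairingZ pairing_uvexp_self /=.
by case: b; rewrite /uvexp /= uexpE; apply/ffunP => z; rewrite !expoE; case: c => /=; ring.
Qed.

(** Up to a common factor, the reflected first term pairs with (n,0) to -1 + w,
    where w is w_n for v_n and 1 - w_n for u_n, and the second term pairs to
    1 - w because the weights at the two neighbours of any column add up to 1. *)
Lemma braid_exp_fixed b d c' c n : (c' == d) = b ->
  refl (n, 0) (braid_exp b d c' c n) = braid_exp b d c' c n.
Proof.
move=> c'd; apply: reflection_fixed.
have sn : pairing (n, 0) (a (shift d n) 0) = 1.
  rewrite pairing_aexp ?node0 // cartan_neq ?adjacent_shift //.
  by rewrite xpair_eqE andbT eq_sym shift_neq.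
have sw b' : pairing (n, 0) (uvexp b' (shift d n)) = uvweight b' (shift d n).
  by rewrite -[n in (n, 0)](shiftK d) pairing_uvexp_shift.
rewrite /braid_exp /reflection !(pairingD, pairingZ) pairing_uvexp_self /= sn sw.
rewrite pairing_uvexp_shift -{}c'd.
have w1 := weight_shift2 k_gt0 balanced d n.
have w2 := weight_shift k_gt0 balanced c d n.
have w3 : weight k l (shift (~~ d) (shift d n)) = weight k l n by rewrite shiftK.
by case: d c' c w1 w2 w3 {sn sw} => [] [] [] /= w1 w2 w3; rewrite ?w1 ?w2 ?w3; ring.
Qed.

Definition braid_factor b d n : expo k l :=
  ((signb b * signb d)%:~R * uvweight b n) *:
    (weight k l (shift d n) *: a (shift d n) 0 - vexp k l (shift d n)).

(** The point is that the difference does not depend on c.  For c = d it is a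
    multiple of w_m a_m^0 - v_m, and for c opposite to d it is the opposite multiple
    of (1 - w_m) a_m^0 - u_m; these agree since u_m v_m = a_m^0. *)
Lemma braid_exp_split b d c' c n : (c' == d) = ~~ b ->
  braid_exp b d c' c n = braid_factor b d n + exchange_exp c b n.
Proof.
move=> c'd.
rewrite /braid_exp /reflection /braid_factor pairingZ pairing_uvexp_shift /=.
have -> : b = ~~ (c' == d) by rewrite c'd negbK.
have w1 : weight k l (shift c' (shift d n)) = if c' == d then 1 - weight k l n else weight k l n.
  by rewrite (weight_shift k_gt0 balanced c' (~~ d)) shiftK; case: (d) (c') => [] [].
rewrite /exchange_exp w1 (weight_shift k_gt0 balanced c d) {w1} /uvexp /uvweight !uexpE.
move: (weight k l n) (weight k l (shift d n)) (a (shift d n) 0) (a n 0)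
  (vexp k l (shift d n)) (vexp k l n) => w w' A A' V V'.
apply/ffunP => z.
case: d c' c {c'd} => [] [] [] /=; rewrite !expoE;
  move: (A z : rat) (A' z : rat) (V z : rat) (V' z : rat) => ? ? ? ?; ring.
Qed.

Lemma braid_factor_fixed b d n : refl (n, 0) (braid_factor b d n) = braid_factor b d n.
Proof.
apply: reflection_fixed.
have sn : pairing (n, 0) (a (shift d n) 0) = 1.
  rewrite pairing_aexp ?node0 // cartan_neq ?adjacent_shift //.
  by rewrite xpair_eqE andbT eq_sym shift_neq.
have sw : pairing (n, 0) (vexp k l (shift d n)) = weight k l (shift d n).
  by rewrite -[n in (n, 0)](shiftK d) (pairing_uvexp_shift true).
by rewrite /braid_factor -scaleN1r pairingZ pairingD !pairingZ sn sw; ring.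
Qed.

End CoxeterExponents.

(** * Transpositions of the variables of a leg *)

Definition swap (i j : int) : int :=
  if 0 < i then if j == i then i + 1 else if j == i + 1 then i else j
  else if j == i then i - 1 else if j == i - 1 then i else j.

Lemma swapK (i : int) : i != 0 -> involutive (swap i).
Proof. by move=> i0 x; rewrite /swap; do ?case: ifP; lia. Qed.

(** The exchanged indices are consecutive on both legs; naming a transposition
    by its smaller index makes the two legs uniform. *)
Definition step_swap (a x : int) : int :=
  if x == a then a + 1 else if x == a + 1 then a else x.

Lemma swapE (i x : int) : swap i x = step_swap (if 0 < i then i else i - 1) x.
Proof.
rewrite /swap /step_swap; case: ifP => // _; rewrite subrK.
by case: (eqVneq x i) => // ->; case: eqP => //; lia.
Qed.

Lemma step_swap_braid (a x : int) :
  step_swap a (step_swap (a + 1) (step_swap a x))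
  = step_swap (a + 1) (step_swap a (step_swap (a + 1) x)).
Proof.
have e1 : (a + 1 == a) = false by lia.
have e2 : (a + 1 + 1 == a) = false by lia.
have e3 : (a + 1 + 1 == a + 1) = false by lia.
have e4 : (a == a + 1) = false by lia.
have e5 : (a == a + 1 + 1) = false by lia.
have e6 : (a + 1 == a + 1 + 1) = false by lia.
pose e := (e1, e2, e3, e4, e5, e6).
have [->|x1] := eqVneq x a; first by rewrite /step_swap !(eqxx, e).
have [->|x2] := eqVneq x (a + 1).
  by rewrite /step_swap !(eqxx, e).
have [->|x3] := eqVneq x (a + 1 + 1).
  by rewrite /step_swap !(eqxx, e).
by rewrite /step_swap !(negPf x1, negPf x2, negPf x3).
Qed.

Lemma swap_braid (i j x : int) : i != 0 -> j != 0 -> j = i + 1 ->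
  swap i (swap j (swap i x)) = swap j (swap i (swap j x)).
Proof.
move=> i0 j0 ij; rewrite !swapE.
have -> : (if 0 < j then j else j - 1) = (if 0 < i then i else i - 1) + 1.
  by do 2 case: ifP; lia.
exact: step_swap_braid.
Qed.

Lemma prod_transpose (R : comNzRingType) (F : nat -> R) (a c : nat) :
  (1 <= a < c)%N ->
  \prod_(1 <= j < c.+1) F (if j == a then a.+1 else if j == a.+1 then a else j) =
  \prod_(1 <= j < c.+1) F j.
Proof.
move=> ac; pose g j := if j == a then a.+1 else if j == a.+1 then a else j.
have gK : involutive g by rewrite /g => j; do !case: eqP; lia.
have g_range j : (g j \in index_iota 1 c.+1) = (j \in index_iota 1 c.+1).
  by rewrite !mem_index_iota /g; do !case: eqP; lia.
rewrite -(big_map g xpredT) /=; apply: perm_big; apply: uniq_perm.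
- by rewrite (map_inj_uniq (inv_inj gK)) iota_uniq.
- exact: iota_uniq.
- by move=> j; rewrite -{1}[j]gK (mem_map (inv_inj gK)) g_range.
Qed.

(** * Numerators of the central reflections *)

Section ExchangePolynomials.
Variables (N : nat) (k l : 'Z_N -> nat).

Section Definitions.
Variables (S : comNzRingType) (M : expo k l -> S) (t : 'Z_N -> int -> S).

(** This is xi_n for c true and eta_n for c false.  The ring is arbitrary because
    the numerators are needed both as polynomials, to construct s_n^0, and as
    elements of L. *)
Definition leg_product (c : bool) (n : 'Z_N) : S :=
  if c then \prod_(1 <= i < (k n).+1) t n i%:Z
  else \prod_(1 <= j < (l n).+1) t n (- j%:Z).

Definition cross_product (c : bool) (n : 'Z_N) : S :=
  leg_product c (n + 1) * leg_product (~~ c) (n - 1).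

Definition exchange_numer (b : bool) (n : 'Z_N) : S :=
  M (exchange_exp k l true b n) * cross_product true n
  + M (exchange_exp k l false b n) * cross_product false n.

Lemma leg_productE c n :
  leg_product c n = \prod_(1 <= j < (if c then k n else l n).+1) t n (signb c * j%:Z).
Proof. by case: c; apply: eq_bigr => j _; rewrite ?mul1r ?mulN1r. Qed.

End Definitions.

Variables (S S' : comNzRingType) (f : {rmorphism S -> S'}).

Lemma rmorph_leg_product t c n :
  f (leg_product t c n) = leg_product (fun m j => f (t m j)) c n.
Proof. by case: c; apply: rmorph_prod. Qed.

Lemma rmorph_cross_product t c n :
  f (cross_product t c n) = cross_product (fun m j => f (t m j)) c n.
Proof. by rewrite [LHS]rmorphM !rmorph_leg_product. Qed.

Lemma rmorph_exchange_numer M t b n : f (exchange_numer M t b n) =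
  f (M (exchange_exp k l true b n)) * cross_product (fun m j => f (t m j)) true n
  + f (M (exchange_exp k l false b n)) * cross_product (fun m j => f (t m j)) false n.
Proof.
by rewrite [LHS]rmorphD [X in X + _]rmorphM [X in _ + X]rmorphM !rmorph_cross_product.
Qed.

End ExchangePolynomials.

Section TauIndices.
Variables (N : nat) (k l : 'Z_N -> nat).
Hypotheses (k_gt0 : forall n, (0 < k n)%N) (l_gt0 : forall n, (0 < l n)%N).
Implicit Types n m : 'Z_N.

Lemma tau_signb b n : is_tau k l n (signb b).
Proof. by rewrite is_tauE; case: b; have := k_gt0 n; have := l_gt0 n; rewrite /signb; lia. Qed.

Lemma tau_leg c n (j : nat) : (1 <= j < (if c then k n else l n).+1)%N ->
  is_tau k l n (signb c * j%:Z).
Proof.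
by rewrite is_tauE /signb; case: c; have := k_gt0 n; have := l_gt0 n; lia.
Qed.

Lemma swap_tau n (i j : int) : is_node k l n i -> i != 0 -> is_tau k l n j ->
  is_tau k l n (swap i j).
Proof. by rewrite is_node_ltE // !is_tauE /swap; do ?case: ifP; lia. Qed.

(** The variables moved by s_n^0, against those that it fixes. *)
Lemma center_or_fixed n m (j : int) : is_tau k l m j ->
  (m = n /\ exists b, j = signb b) \/ (m != n) || (j != 1) && (j != -1).
Proof.
move=> mj; have [mn|mn] := eqVneq m n; last by right.
have [->|j1] := eqVneq j 1; first by left; split=> //; exists true.
have [->|j2] := eqVneq j (-1); first by left; split=> //; exists false.
by right.
Qed.

End TauIndices.

(** * Coxeter relations on the tau variables *)

Section AbstractAction.
Variables (N : nat) (N3 : (3 <= N)%N) (k l : 'Z_N -> nat).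
Hypotheses (k_gt0 : forall n, (0 < k n)%N) (l_gt0 : forall n, (0 < l n)%N).
Hypothesis balanced :
  forall n, (k (n - 1)%R * k (n + 1)%R = l (n - 1)%R * l (n + 1)%R)%N.
Variables (p : nat) (p_suitable : suitable k l p).
Variables (L : fieldType) (M : expo k l -> L) (t : 'Z_N -> int -> L).
Hypothesis MD : forall e1 e2, p_integral p e1 -> p_integral p e2 ->
  M (e1 + e2) = M e1 * M e2.
Hypothesis t_neq0 : forall n j, is_tau k l n j -> t n j != 0.
Local Notation refl := (@reflection N k l).
Local Notation exchange_exp := (exchange_exp k l).
Local Notation braid_exp := (@braid_exp N k l).
Local Notation braid_factor := (@braid_factor N k l).

Local Notation legprod := (leg_product k l t).
Local Notation cross := (cross_product k l t).
Local Notation numer := (exchange_numer M t).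

Lemma numerE (c b : bool) n :
  numer b n = M (exchange_exp c b n) * cross c n + M (exchange_exp (~~ c) b n) * cross (~~ c) n.
Proof. by case: c; rewrite /exchange_numer // addrC. Qed.

Let tau_signb := tau_signb k_gt0 l_gt0.
Let tau_leg := @tau_leg N k l k_gt0 l_gt0.
Let swap_tau := @swap_tau N k l k_gt0 l_gt0.
Let exchange_exp_int := p_integral_exchange_exp k_gt0 balanced p_suitable.

Variable s : 'Z_N -> int -> {rmorphism L -> L}.
Hypothesis sM : forall n i e, is_node k l n i -> p_integral p e ->
  s n i (M e) = M (refl (n, i) e).
Hypothesis s_leg : forall n i m j, is_node k l n i -> i != 0 -> is_tau k l m j ->
  s n i (t m j) = if m == n then t n (swap i j) else t m j.
Hypothesis s_numer : forall n b, s n 0 (t n (signb b)) = numer b n / t n (signb (~~ b)).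
Hypothesis s_fix : forall n m j, is_tau k l m j ->
  (m != n) || (j != 1) && (j != -1) -> s n 0 (t m j) = t m j.

(** A leg reflection permutes the factors of xi_n or eta_n. *)
Lemma legprod_leg c n m (i : int) : is_node k l n i -> i != 0 ->
  s n i (legprod c m) = legprod c m.
Proof.
move=> ni i0; rewrite leg_productE rmorph_prod /=.
under eq_big_nat => j jP do rewrite s_leg ?tau_leg //.
have [->|//] := eqVneq m n.
have [ic|ic] := boolP ((0 < i) == c); last first.
  apply: eq_big_nat => j jP; congr (t n _).
  move: ic jP i0; rewrite /swap /signb; case: c; do ?case: ifP; lia.
have [a ia aP] : exists2 a : nat, i = signb c * a%:Z & (1 <= a < if c then k n else l n)%N.
  exists `|i|%N; move: ic ni i0; rewrite is_node_ltE // /signb; case: c; lia.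
rewrite -[RHS](prod_transpose (fun j => t n (signb c * j%:Z)) aP).
apply: eq_big_nat => j jP; congr (t n _).
rewrite ia; move: aP jP; rewrite /swap /signb.
case: c {ic ia} => aP jP; rewrite !(mul1r, mulN1r); do ?case: ifP; lia.
Qed.

Lemma cross_leg c n m (i : int) : is_node k l n i -> i != 0 ->
  s n i (cross c m) = cross c m.
Proof. by move=> ni i0; rewrite /cross_product rmorphM !legprod_leg. Qed.

Lemma legprod_fix c n m : m != n -> s n 0 (legprod c m) = legprod c m.
Proof.
move=> mn; rewrite leg_productE rmorph_prod; apply: eq_big_nat => j jP.
by rewrite s_fix ?mn ?tau_leg.
Qed.

Lemma legprod_self c n :
  s n 0 (legprod c n) = legprod c n * numer c n / (t n 1 * t n (-1)).
Proof.
have t1 := t_neq0 (tau_signb true n); have tN1 := t_neq0 (tau_signb false n).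
have leg0 : (1 < (if c then k n else l n).+1)%N.
  by case: c; rewrite ltnS ?k_gt0 ?l_gt0.
rewrite leg_productE big_ltn // rmorphM rmorph_prod mulr1 s_numer.
rewrite (eq_big_nat _ _ (F2 := fun j => t n (signb c * j%:Z))) => [|j jP].
  by clear leg0; case: c => /=; field; rewrite t1 tN1.
apply: s_fix; first by apply: tau_leg; lia.
by rewrite eqxx /signb; case: c jP {leg0}; lia.
Qed.

Lemma cross_fix c n m : m != n + 1 -> m != n - 1 -> s m 0 (cross c n) = cross c n.
Proof. by move=> m1 m2; rewrite /cross_product rmorphM !legprod_fix // eq_sym. Qed.

Lemma cross_self c n : s n 0 (cross c n) = cross c n.
Proof. by rewrite cross_fix // eq_sym ?Zp_neq_succ ?Zp_neq_pred. Qed.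

(** The cross product at n contains xi_m or eta_m for each neighbour m, according
    to whether c == d. *)
Lemma cross_shift c d n : s (shift d n) 0 (cross c n) =
  cross c n * numer (c == d) (shift d n) / (t (shift d n) 1 * t (shift d n) (-1)).
Proof.
have pm := Zp_succ_neq_pred N3 n.
rewrite /cross_product rmorphM; case: d => /=.
  rewrite legprod_self legprod_fix; last by rewrite eq_sym pm.
  by rewrite eqb_id -!mulrA; congr (_ * _); rewrite [RHS]mulrC -mulrA.
rewrite legprod_self legprod_fix; last by rewrite pm.
by case: c; rewrite -!mulrA.
Qed.

Lemma rmorph_numer (f : {rmorphism L -> L}) b n :
  f (numer b n) = f (M (exchange_exp true b n)) * f (cross true n)
    + f (M (exchange_exp false b n)) * f (cross false n).
Proof. by rewrite /exchange_numer rmorphD; congr (_ + _); exact: rmorphM. Qed.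

Lemma numer_flip b n : s n 0 (numer b n) = numer (~~ b) n.
Proof.
have int c := exchange_exp_int c b n.
rewrite rmorph_numer !sM ?node0 //.
by rewrite !exchange_exp_flip // !cross_self.
Qed.

(** A field morphism does not send the variable tau_n^(+-1) to zero. *)
Lemma numer_neq0 b n : numer b n != 0.
Proof.
have: s n 0 (t n (signb b)) != 0 by rewrite fmorph_eq0 t_neq0 ?tau_signb.
by apply: contra_neq => f0; rewrite s_numer f0 mul0r.
Qed.

Lemma numer_far b n m : m != n -> ~~ adjacent (m, 0) (n, 0) ->
  s m 0 (numer b n) = numer b n.
Proof.
move=> mn far; have int c := exchange_exp_int c b n.
have [m1 m2] : m != n + 1 /\ m != n - 1.
  by move: far; rewrite /adjacent orbC -/(adjacent _ _) adjacent0 negb_or => /andP.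
rewrite rmorph_numer !sM ?node0 //.
by rewrite !cross_fix // !reflection_fixed // /exchange_exp pairingZ pairing_uvexp_far ?mulr0.
Qed.

(** Leg reflections fix v_n except s_n^(-1), and u_n except s_n^1. *)
Lemma numer_leg b n m (i : int) : is_node k l m i -> i != 0 ->
  (m != n) || (i != - signb b) -> s m i (numer b n) = numer b n.
Proof.
move=> mi i0 mn; have int c := exchange_exp_int c b n.
rewrite rmorph_numer !sM // !cross_leg //.
have fix_exchange_exp c : refl (m, i) (exchange_exp c b n) = exchange_exp c b n.
  apply: reflection_fixed; rewrite /exchange_exp pairingZ pairing_uvexp_leg //.
  by rewrite -[_ && _]negbK negb_and mn mulr0.
by rewrite !fix_exchange_exp.
Qed.

(** In the remaining case the factor gained by the numerator b is the root at
    (n, -signb b), whose pairing with (n,0) is 1; it cancels the pairing -1 of u_n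
    or v_n itself. *)
Lemma numer_leg_fixed b n : is_node k l n (- signb b) ->
  s n 0 (s n (- signb b) (numer b n)) = s n (- signb b) (numer b n).
Proof.
move=> nb; have int c := exchange_exp_int c b n.
have b0 : - signb b != 0 by case: (b).
rewrite rmorph_numer !sM // !cross_leg //.
rewrite rmorphD !(rmorphM _ (M _)) !sM ?node0 //; try exact: p_integral_reflection.
rewrite !cross_self.
have fix_exchange_exp c : refl (n, 0) (refl (n, - signb b) (exchange_exp c b n))
    = refl (n, - signb b) (exchange_exp c b n).
  apply: reflection_fixed; rewrite /reflection /exchange_exp !(pairingD, pairingZ) /=.
  rewrite pairing_uvexp_self // pairing_uvexp_leg // !eqxx pairing_aexp //.
  rewrite cartan_neq ?xpair_eqE ?(negPf b0) ?andbF //; last by rewrite eq_sym (negPf b0) andbF.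
  have -> : adjacent (n, 0) (n, - signb b) = true.
    by rewrite /adjacent /arrow /= eqxx; case: (b).
  rewrite /=; ring.
by rewrite !fix_exchange_exp.
Qed.

(** The braid relation of two adjacent central reflections, with the
    denominators cleared. *)
Lemma braid_numer b d n (m := shift d n) :
  t n 1 * t n (-1) * s n 0 (s m 0 (numer b n)) = numer (~~ b) n * s m 0 (numer b n).
Proof.
have tT x : t x 1 * t x (-1) != 0.
  by rewrite mulf_neq0 ?(t_neq0 (tau_signb true _)) ?(t_neq0 (tau_signb false _)).
have int := exchange_exp_int.
have int' c c' : p_integral p (braid_exp b d c' c n).
  by apply: p_integralD => //; apply: p_integral_reflection.
have split_exp c := braid_exp_split N3 k_gt0 l_gt0 balanced (b := b) (d := d) (c' := b != d) c n.
have intF : p_integral p (braid_factor b d n).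
  have -> : braid_factor b d n = braid_exp b d (b != d) true n - exchange_exp true b n.
    by rewrite split_exp ?addrK //; case: (b) (d) => [] [].
  by apply: p_integralB.
(* The value of c' for the fixed coefficients is b == d; for the other value the
   coefficients have the common factor C. *)
pose A := M (braid_exp b d (b == d) true n) * cross true n
  + M (braid_exp b d (b == d) false n) * cross false n.
pose C := M (braid_factor b d n).
have braidM c : t m 1 * t m (-1) * (M (refl (m, 0) (exchange_exp c b n)) *
      (cross c n * numer (c == d) m / (t m 1 * t m (-1)))) =
    M (braid_exp b d (b == d) c n) * cross c n * cross (b == d) m
    + C * (M (exchange_exp c b n) * cross c n) * cross (b != d) m.
  have -> : C * (M (exchange_exp c b n) * cross c n) = M (braid_exp b d (b != d) c n) * cross c n.
    rewrite mulrA -MD // split_exp //; by case: (b) (d) => [] [].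
  have MB c' : M (braid_exp b d c' c n) =
      M (refl (m, 0) (exchange_exp c b n)) * M (exchange_exp c' (c == d) m).
    by apply: MD => //; apply: p_integral_reflection.
  rewrite !MB (numerE (b == d)); move: (tT m); move: (t m 1 * t m (-1)) => T T0.
  rewrite -/m; field; exact: T0.
have E : t m 1 * t m (-1) * s m 0 (numer b n) =
    A * cross (b == d) m + C * numer b n * cross (b != d) m.
  rewrite rmorph_numer !sM ?node0 // !cross_shift -/m mulrDr !braidM.
  rewrite /A /exchange_numer; ring.
have mn : shift (~~ d) m = n by rewrite /m shiftK.
have crossm c : s n 0 (cross c m) =
    cross c m * numer (c == ~~ d) n / (t n 1 * t n (-1)).
  by have := cross_shift c (~~ d) m; rewrite mn.
have sA : s n 0 A = A.
  have bd : ((b == d) == d) = b by case: (b) (d) => [] [].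
  rewrite /A rmorphD !(rmorphM _ (M _)) !sM ?node0 // !cross_self.
  by rewrite !braid_exp_fixed.
have sC : s n 0 C = C by rewrite /C sM ?node0 // braid_factor_fixed.
have sT : s n 0 (t m 1 * t m (-1)) = t m 1 * t m (-1).
  have nm : m != n by rewrite /m shift_neq.
  by rewrite rmorphM !s_fix ?nm ?(tau_signb true) ?(tau_signb false).
apply: (mulfI (tT m)); rewrite mulrCA [RHS]mulrCA -{1}sT -rmorphM E.
rewrite rmorphD (rmorphM _ A) (rmorphM _ (C * _)) (rmorphM _ C) sA sC numer_flip !crossm.
have -> : ((b == d) == ~~ d) = ~~ b by case: (b) (d) => [] [].
have -> : ((b != d) == ~~ d) = b by case: (b) (d) => [] [].
move: (tT n) A C (numer _ _) (numer _ _) (cross _ _) (cross _ _) {E sA sC braidM crossm}.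
by move: (t n 1 * t n (-1)) => T T0 *; field.
Qed.

Lemma t_signb_neq0 n b : t n (signb b) != 0.
Proof. by rewrite t_neq0 ?tau_signb. Qed.

Lemma s_t_involutive n (i : int) m (j : int) : is_node k l n i -> is_tau k l m j ->
  s n i (s n i (t m j)) = t m j.
Proof.
move=> ni mj; have [i0|i0] := eqVneq i 0; last first.
  rewrite (s_leg ni i0 mj); have [mn|mn] := eqVneq m n; last first.
    by rewrite (s_leg ni i0 mj) (negPf mn).
  subst m; rewrite (s_leg ni i0) ?swap_tau // eqxx; congr (t _ _).
  by rewrite /swap; do ?case: ifP; lia.
subst i; have [[-> [b ->]]|far] := center_or_fixed n mj; last first.
  by rewrite !s_fix.
rewrite s_numer fmorph_div numer_flip s_numer negbK invf_div mulrCA divff ?mulr1 //.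
exact: numer_neq0.
Qed.

Lemma s_t_comm00 n m m' (j : int) : m != n -> ~~ adjacent (n, 0) (m, 0) ->
  is_tau k l m' j -> s n 0 (s m 0 (t m' j)) = s m 0 (s n 0 (t m' j)).
Proof.
move=> mn far m'j.
wlog [m'n [b jb]] : n m mn far / m' = n /\ exists b, j = signb b => [th|].
  have [in_n|fix_n] := center_or_fixed n m'j; first exact: th.
  have [in_m|fix_m] := center_or_fixed m m'j; last by rewrite !s_fix.
  symmetry; apply: th => //; first by rewrite eq_sym.
  by rewrite /adjacent orbC.
rewrite {}m'n {}jb in m'j *.
have fix_b b' : s m 0 (t n (signb b')) = t n (signb b').
  by rewrite s_fix ?tau_signb // eq_sym mn.
rewrite fix_b s_numer fmorph_div fix_b numer_far //.
by rewrite /adjacent orbC.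
Qed.

Lemma s_t_comm0leg n m (i : int) m' (j : int) : is_node k l m i -> i != 0 ->
  ~~ adjacent (n, 0) (m, i) -> is_tau k l m' j ->
  s n 0 (s m i (t m' j)) = s m i (s n 0 (t m' j)).
Proof.
move=> mi i0 far m'j.
have imn : m = n -> (i != 1) && (i != -1).
  move=> mn; move: far; rewrite mn /adjacent /arrow /= eqxx; lia.
have fix_b b : s m i (t n (signb b)) = t n (signb b).
  rewrite s_leg ?tau_signb //; case: eqP => // nm; rewrite nm; congr (t _ _).
  have := imn (esym nm); rewrite /swap /signb; case: (b); do ?case: ifP; lia.
have [[-> [b ->]]|fixed] := center_or_fixed n m'j; last first.
  rewrite (s_fix m'j fixed) (s_leg mi i0 m'j).
  have [mm|//] := eqVneq m' m; last by rewrite s_fix.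
  subst m'; rewrite s_fix ?swap_tau //.
  have [mn|//] := eqVneq m n; move: fixed (imn mn); rewrite mn eqxx /= /swap.
  by do ?case: ifP; lia.
rewrite fix_b s_numer fmorph_div fix_b numer_leg //.
by case: eqP => //= /imn; case: (b); rewrite /signb; lia.
Qed.

Lemma s_t_commleg n (i : int) m (j : int) m' (j' : int) :
    is_node k l n i -> is_node k l m j -> i != 0 -> j != 0 -> (n, i) != (m, j) ->
    ~~ adjacent (n, i) (m, j) -> is_tau k l m' j' ->
  s n i (s m j (t m' j')) = s m j (s n i (t m' j')).
Proof.
move=> ni mj i0 j0 nimj far m'j'.
have [nm|nm] := eqVneq n m; last first.
  rewrite (s_leg ni i0 m'j') (s_leg mj j0 m'j').
  have [m'n|m'n] := eqVneq m' n.
    have m'm : m' != m by rewrite m'n.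
    rewrite (negPf m'm) (s_leg ni i0 m'j') m'n eqxx (s_leg mj j0) -?m'n ?swap_tau -?m'n //.
      by rewrite (negPf m'm).
    by rewrite m'n.
  have [m'm|m'm] := eqVneq m' m; last first.
    by rewrite (s_leg ni i0 m'j') (s_leg mj j0 m'j') (negPf m'n) (negPf m'm).
  subst m'; rewrite (s_leg ni i0) ?swap_tau // (negPf m'n).
  by rewrite (s_leg mj j0 m'j') eqxx.
subst m; move: nimj far; rewrite xpair_eqE eqxx /= /adjacent /arrow /= eqxx.
rewrite (negPf i0) (negPf j0) /= !orbF => ij far.
rewrite (s_leg ni i0 m'j') (s_leg mj j0 m'j').
have [m'n|m'n] := eqVneq m' n; last first.
  by rewrite (s_leg ni i0 m'j') (s_leg mj j0 m'j') (negPf m'n).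
subst m'; rewrite (s_leg ni i0) ?(s_leg mj j0) ?swap_tau // eqxx; congr (t _ _).
by rewrite /swap; do ?case: ifP; lia.
Qed.

Lemma s_t_braidleg n (i j : int) m (j' : int) :
    is_node k l n i -> is_node k l n j -> i != 0 -> j != 0 -> j = i + 1 ->
    is_tau k l m j' ->
  s n i (s n j (s n i (t m j'))) = s n j (s n i (s n j (t m j'))).
Proof.
move=> ni nj i0 j0 ij mj'.
have E (i' : int) : is_node k l n i' -> i' != 0 -> forall j'', is_tau k l m j'' ->
    s n i' (t m j'') = t m (if m == n then swap i' j'' else j'').
  by move=> ni' i'0 j'' mj''; rewrite (s_leg ni' i'0 mj''); case: eqP => // ->.
have Etau (i' : int) : is_node k l n i' -> i' != 0 -> forall j'', is_tau k l m j'' ->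
    is_tau k l m (if m == n then swap i' j'' else j'').
  by move=> ni' i'0 j'' mj''; case: eqP => // mn; subst m; rewrite swap_tau.
rewrite !(E, Etau) //; congr (t _ _).
by case: eqP => // _; apply: swap_braid.
Qed.

Lemma s_t_braid00 d n m' (j : int) : is_tau k l m' j ->
  s n 0 (s (shift d n) 0 (s n 0 (t m' j))) =
  s (shift d n) 0 (s n 0 (s (shift d n) 0 (t m' j))).
Proof.
move=> m'j.
wlog [m'n [b jb]] : d n / m' = n /\ exists b, j = signb b => [th|].
  have [in_n|fix_n] := center_or_fixed n m'j; first exact: th.
  have [in_m|fix_m] := center_or_fixed (shift d n) m'j; last by rewrite !s_fix.
  by have := th (~~ d) _ in_m; rewrite shiftK => ->.
rewrite {}m'n {}jb in m'j *.
have fix_b b' : s (shift d n) 0 (t n (signb b')) = t n (signb b').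
  by rewrite s_fix ?tau_signb // eq_sym shift_neq.
have t1 := t_signb_neq0 n b; have t2 := t_signb_neq0 n (~~ b); have f0 := numer_neq0 (~~ b) n.
rewrite fix_b s_numer !fmorph_div !fix_b s_numer negbK.
have B := braid_numer b d n.
have T : t n 1 * t n (-1) = t n (signb b) * t n (signb (~~ b)).
  by case: (b) => //; rewrite mulrC.
rewrite T in B; move: B; set Y := s (shift d n) 0 (numer b n); set X := s n 0 Y => B.
have -> : X = numer (~~ b) n * Y / (t n (signb b) * t n (signb (~~ b))).
  by rewrite -B; field; rewrite t1 t2.
by field; rewrite t1 t2 f0.
Qed.

(** With y = signb c: on the three variables tau_n^y, tau_n^(2y), tau_n^(-y) both
    sides can be computed, and all other variables are fixed by both
    reflections. *)
Lemma s_t_braid0leg c n m (j : int) : is_node k l n (signb c) -> is_tau k l m j ->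
  s n 0 (s n (signb c) (s n 0 (t m j))) = s n (signb c) (s n 0 (s n (signb c) (t m j))).
Proof.
move=> nc mj; have c0 : signb c != 0 by case: (c).
have t1 := tau_signb c n; have t2 := tau_signb (~~ c) n.
have tt := swap_tau nc c0 t1.
have E1 : s n (signb c) (t n (signb c)) = t n (swap (signb c) (signb c)).
  by rewrite s_leg ?eqxx.
have E2 : s n (signb c) (t n (swap (signb c) (signb c))) = t n (signb c).
  by rewrite s_leg ?eqxx //; congr (t _ _); case: (c).
have E3 : s n (signb c) (t n (signb (~~ c))) = t n (signb (~~ c)).
  by rewrite s_leg ?eqxx //; congr (t _ _); case: (c).
have F : s n 0 (t n (swap (signb c) (signb c))) = t n (swap (signb c) (signb c)).
  by rewrite s_fix //; case: (c); rewrite orbT.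
have G : s n (signb c) (numer c n) = numer c n.
  by rewrite numer_leg //; case: (c); rewrite orbT.
have I0 b : s n 0 (s n 0 (t n (signb b))) = t n (signb b).
  by rewrite s_t_involutive ?node0 ?tau_signb.
have [mn|mn] := eqVneq m n; last first.
  have fix0 : s n 0 (t m j) = t m j by rewrite s_fix ?mn.
  have fix1 : s n (signb c) (t m j) = t m j by rewrite s_leg ?(negPf mn).
  by rewrite !(fix0, fix1).
subst m; have [->|j1] := eqVneq j (signb c).
  rewrite E1 F E2 s_numer !fmorph_div E3 G -fmorph_div -s_numer.
  exact: I0.
have [->|j2] := eqVneq j (signb (~~ c)).
  rewrite E3 s_numer negbK !fmorph_div E1 F.
  congr (_ / _); have := @numer_leg_fixed (~~ c) n.
  have -> : - signb (~~ c) = signb c by case: (c).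
  by apply.
have [->|j3] := eqVneq j (swap (signb c) (signb c)).
  by rewrite F E2 s_numer fmorph_div E3 G.
have fix0 : s n 0 (t n j) = t n j.
  by rewrite s_fix // eqxx /=; move: j1 j2; case: (c) => /=; rewrite /signb; lia.
have fix1 : s n (signb c) (t n j) = t n j.
  rewrite s_leg // eqxx; congr (t _ _).
  by move: j1 j2 j3; case: (c) => /=; rewrite /signb /swap; do ?case: ifP; lia.
by rewrite !(fix0, fix1).
Qed.

Lemma s_t_comm n (i : int) m (j : int) m' (j' : int) :
    is_node k l n i -> is_node k l m j -> (n, i) != (m, j) ->
    ~~ adjacent (n, i) (m, j) -> is_tau k l m' j' ->
  s n i (s m j (t m' j')) = s m j (s n i (t m' j')).
Proof.
move=> ni mj neq far m'j'.
have [i0|i0] := eqVneq i 0; have [j0|j0] := eqVneq j 0.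
- rewrite i0 j0 in neq far *; apply: s_t_comm00 => //.
  by apply: contraNneq neq => ->.
- by rewrite i0 in far *; apply: s_t_comm0leg.
- rewrite j0 in far *; symmetry; apply: s_t_comm0leg => //.
  by rewrite /adjacent orbC.
- exact: s_t_commleg.
Qed.

Lemma s_t_braid n (i : int) m (j : int) m' (j' : int) :
    is_node k l n i -> is_node k l m j -> (n, i) != (m, j) ->
    adjacent (n, i) (m, j) -> is_tau k l m' j' ->
  s n i (s m j (s n i (t m' j'))) = s m j (s n i (s m j (t m' j'))).
Proof.
move=> ni mj neq adj m'j'.
wlog: n i m j ni mj neq adj / arrow (n, i) (m, j) => [th|].
  have [fwd|bwd] := orP adj; first exact: th.
  by symmetry; apply: th => //; rewrite 1?eq_sym // /adjacent orbC.
rewrite /arrow /= => /orP[/andP[/eqP mn /eqP ij]|/and3P[/eqP i0 /eqP j0 /eqP mn]].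
  subst m; have [i0|i0] := eqVneq i 0.
    by subst i; rewrite add0r in ij; subst j; apply: (s_t_braid0leg (c := true)).
  have [j0|j0] := eqVneq j 0; last exact: s_t_braidleg.
  have iN : i = signb false by rewrite /signb; lia.
  by symmetry; subst i j; apply: s_t_braid0leg.
by subst i j m; apply: (s_t_braid00 true).
Qed.

End AbstractAction.

(** * Monomials in the roots *)

Section Monomials.
Variables (N : nat) (k l : 'Z_N -> nat).
Variables (F : fieldType) (g : 'Z_N -> int -> F) (p : nat).
Hypothesis g_neq0 : forall n i, is_node k l n i -> g n i != 0.

(** The monomials of K with exponents in (1/p) Z, and their images in L, are both
    of this form, for two families g of p-th roots. *)
Definition root_monomial (e : expo k l) : F :=
  \prod_(x : node k l) g (ssval x).1 (ssval x).2 ^ numq (p%:R * e x).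

Lemma val_node (x : node k l) : is_node k l (ssval x).1 (ssval x).2.
Proof. by rewrite /is_node -surjective_pairing (valP x). Qed.

Lemma node_neq0 (x : node k l) : g (ssval x).1 (ssval x).2 != 0.
Proof. exact/g_neq0/val_node. Qed.

Lemma root_monomialD e1 e2 : p_integral p e1 -> p_integral p e2 ->
  root_monomial (e1 + e2) = root_monomial e1 * root_monomial e2.
Proof.
move=> p1 p2; rewrite -big_split; apply: eq_bigr => x _ /=.
rewrite -expfzDr ?node_neq0 // ffunE mulrDr; congr (_ ^ _).
by rewrite -[p%:R * e1 x]numqK // -[p%:R * e2 x in LHS]numqK // -rmorphD !numq_int.
Qed.

Lemma root_monomial_aexp (c : rat) n i : is_node k l n i ->
  root_monomial (c *: aexp k l n i) = g n i ^ numq (p%:R * c).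
Proof.
move=> ni; pose z : node k l := SeqSub ni.
rewrite /root_monomial (bigD1 z) //= big1 => [|x /negPf xz].
  by rewrite mulr1 expoZE ffunE /= eqxx mulr1.
by rewrite expoZE ffunE -[(n, i)]/(val z) (inj_eq val_inj) xz !mulr0.
Qed.

Lemma prodr_expz (I : Type) (r : seq I) (x : F) (f : I -> int) : x != 0 ->
  \prod_(i <- r) x ^ f i = x ^ (\sum_(i <- r) f i).
Proof.
move=> x0; elim: r => [|i r IHr]; first by rewrite !big_nil expr0z.
by rewrite !big_cons IHr expfzDr.
Qed.

(** The action on roots, given on the p-th roots by the Cartan matrix, is the
    reflection of exponent vectors. *)
Lemma root_monomial_reflection (s : {rmorphism F -> F}) n i e :
    is_node k l n i -> p_integral p e ->
    (forall m j, is_node k l m j ->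
       s (g m j) = g m j * g n i ^ cartan (n, i) (m, j)) ->
  s (root_monomial e) = root_monomial (reflection (n, i) e).
Proof.
move=> ni pe sg.
have pP : (\sum_(x : node k l) cartan (n, i) (ssval x) * numq (p%:R * e x))%:~R
    = p%:R * pairing (n, i) e.
  rewrite mulr_sumr rmorph_sum; apply: eq_bigr => x _ /=.
  by rewrite rmorphM /= numqK ?pe // mulrCA.
have pPa : p_integral p (pairing (n, i) e *: aexp k l n i).
  by move=> x; rewrite expoZE ffunE mulrA -pP rpredM ?intr_int ?natr_int.
rewrite /reflection root_monomialD // root_monomial_aexp // -pP numq_int -prodr_expz ?g_neq0 //.
rewrite rmorph_prod -big_split; apply: eq_bigr => x _ /=.
rewrite fmorphXz sg ?expfzMl ?exprz_exp -?surjective_pairing //.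
exact: val_node.
Qed.

End Monomials.

(** * Automorphisms of a field of rational functions in the tau variables *)

Section TauField.
Variables (N : nat) (k l : 'Z_N -> nat).
Hypotheses (k_gt0 : forall n, (0 < k n)%N) (l_gt0 : forall n, (0 < l n)%N).
Variable K : fieldType.
Local Notation A := {mpoly K[#|tau_index k l|]}.

Definition tau_poly (n : 'Z_N) (i : int) : A :=
  if insub (n, i) is Some x then 'X_(enum_rank (x : tau_index k l)) else 0.

Lemma tau_polyE n i (ni : is_tau k l n i) :
  tau_poly n i = 'X_(enum_rank (SeqSub ni : tau_index k l)).
Proof. by rewrite /tau_poly insubT. Qed.

Lemma tau_indexP (i : 'I_#|tau_index k l|) :
  exists m j (mj : is_tau k l m j), i = enum_rank (SeqSub mj : tau_index k l).
Proof.
rewrite -(enum_valK i); case: (enum_val i) => -[m j] mj; exists m, j, mj.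
by [].
Qed.

Lemma tau_rank_inj n i m j (ni : is_tau k l n i) (mj : is_tau k l m j) :
  (enum_rank (SeqSub ni : tau_index k l) == enum_rank (SeqSub mj : tau_index k l))
  = ((n, i) == (m, j)).
Proof. by rewrite (inj_eq enum_rank_inj). Qed.

Variable sigma : {rmorphism K -> K}.
Hypothesis sigmaK : involutive sigma.

(** The automorphism s_n^i for i nonzero, given its restriction sigma to the
    coefficient field. *)
Lemma swap_automorphism n (i : int) : is_node k l n i -> i != 0 ->
  exists g : {rmorphism {fraction A} -> {fraction A}},
    (forall c, g (tofrac c%:MP) = tofrac (sigma c)%:MP) /\
    (forall m j, is_tau k l m j -> g (tofrac (tau_poly m j)) =
       tofrac (tau_poly m (if m == n then swap i j else j))).
Proof.
move=> ni i0.
pose tr (y : 'Z_N * int) := (y.1, if y.1 == n then swap i y.2 else y.2).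
have tr_tau m j : is_tau k l m j -> is_tau k l m (if m == n then swap i j else j).
  by move=> mj; case: eqP => // mn; subst m; apply: (swap_tau k_gt0 l_gt0).
pose pi (r : 'I_#|tau_index k l|) : 'I_#|tau_index k l| :=
  enum_rank (insubd (enum_val r) (tr (ssval (enum_val r))) : tau_index k l).
have piE m j (mj : is_tau k l m j) :
    pi (enum_rank (SeqSub mj : tau_index k l)) = enum_rank (SeqSub (tr_tau m j mj) : tau_index k l).
  rewrite /pi enum_rankK; congr enum_rank; apply: val_inj.
  by rewrite /= val_insubd; rewrite ifT //; apply: tr_tau.
have piK : involutive pi.
  move=> r; have [m [j [mj ->]]] := tau_indexP r; rewrite !piE.
  congr enum_rank; apply: val_inj => /=; congr (_, _).
  by case: eqP => // _; apply: swapK.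
have [g [gC gX]] := relabelling_substitution sigmaK piK.
exists g; split=> [c|m j mj]; first exact: gC.
by rewrite (tau_polyE mj) gX piE -tau_polyE.
Qed.

Variable mono : expo k l -> K.
Hypothesis N3 : (3 <= N)%N.
Local Notation P := (exchange_numer (fun e => (mono e)%:MP : A) tau_poly).

(** One of the two terms of the numerator contains tau_(n+1)^1 and the other does
    not. *)
Lemma exchange_numer_poly_neq0 b n : mono (exchange_exp k l false b n) != 0 -> P b n != 0.
Proof.
apply: contra_neq => P0.
(* Setting tau_(n+1)^1 to 0 and the other variables to 1 leaves the second
   coefficient. *)
pose v (i : 'I_#|tau_index k l|) : K := (ssval (enum_val i) != (n + 1, 1))%:R.
have vt m j : is_tau k l m j -> (tau_poly m j).@[v] = ((m, j) != (n + 1, 1))%:R.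
  by move=> mj; rewrite (tau_polyE mj) mevalXU /v enum_rankK.
have := congr1 (meval v) P0; rewrite meval0 (rmorph_exchange_numer (meval v)) /= !mevalC.
rewrite /cross_product !leg_productE /=.
rewrite (big_ltn (n := (k (n + 1)%R).+1)) ?ltnS ?k_gt0 //.
rewrite vt ?(tau_signb k_gt0 l_gt0 true) // mul1r eqxx /= mul0r mul0r mulr0 add0r.
rewrite !big_nat !big1 ?mulr1 // => j jP.
  rewrite vt; last exact: (@tau_leg _ _ _ k_gt0 l_gt0 true).
  by rewrite xpair_eqE eq_sym Zp_succ_neq_pred.
rewrite vt; last exact: (@tau_leg _ _ _ k_gt0 l_gt0 false).
by rewrite xpair_eqE mulN1r; case: j jP => // j _; rewrite andbF.
Qed.

(** The automorphism s_n^0, given an involution sigma of the coefficient field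
    that acts on the four coefficients as the reflection does. *)
Lemma exchange_automorphism n :
    (forall b, mono (exchange_exp k l false b n) != 0) ->
    (forall c b, sigma (mono (exchange_exp k l c b n)) = mono (exchange_exp k l c (~~ b) n)) ->
  exists g : {rmorphism {fraction A} -> {fraction A}},
    [/\ forall c, g (tofrac c%:MP) = tofrac (sigma c)%:MP,
        forall b, g (tofrac (tau_poly n (signb b))) =
          tofrac (P b n) / tofrac (tau_poly n (signb (~~ b)))
      & forall m j, is_tau k l m j -> (m != n) || (j != 1) && (j != -1) ->
          g (tofrac (tau_poly m j)) = tofrac (tau_poly m j)].
Proof.
move=> mono0 sigma_mono.
pose x b := enum_rank (SeqSub (tau_signb k_gt0 l_gt0 b n) : tau_index k l).
have xE b : tau_poly n (signb b) = 'X_(x b) by apply: tau_polyE.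
have [||f fC fX b|g [gC gx g_fix]] := @exchange_substitution K _ sigma sigmaK x (P^~ n).
- by rewrite tau_rank_inj xpair_eqE andbC.
- by move=> b; apply: exchange_numer_poly_neq0.
- have f_fix m j : is_tau k l m j -> (m != n) || (j != 1) && (j != -1) ->
      f (tau_poly m j) = tofrac (tau_poly m j).
    move=> mj far; rewrite (tau_polyE mj); apply: fX => c.
    rewrite tau_rank_inj xpair_eqE negb_and; case/orP: far => [->//|/andP[j1 j2]].
    by case: c; rewrite ?j1 ?j2 orbT.
  have f_leg c m : m != n ->
      leg_product k l (fun m j => f (tau_poly m j)) c m =
      leg_product k l (fun m j => tofrac (tau_poly m j)) c m.
    move=> mn; rewrite !leg_productE; apply: eq_big_nat => j jP.
    by apply: f_fix; [exact: (tau_leg k_gt0 l_gt0) | rewrite mn].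
  have f_cross c : cross_product k l (fun m j => f (tau_poly m j)) c n =
      cross_product k l (fun m j => tofrac (tau_poly m j)) c n.
    by rewrite /cross_product !f_leg ?Zp_neq_succ ?Zp_neq_pred.
  rewrite (rmorph_exchange_numer f) !f_cross !fC !sigma_mono.
  symmetry; exact: (rmorph_exchange_numer (@tofrac A)).
exists g; split; first exact: gC.
  by move=> b; rewrite !xE; apply: gx.
move=> m j mj far; rewrite (tau_polyE mj); apply: g_fix => b.
rewrite tau_rank_inj xpair_eqE negb_and; case/orP: far => [->//|/andP[j1 j2]].
by case: b; rewrite ?j1 ?j2 orbT.
Qed.

End TauField.

(** * The simple reflections of L *)

Section Concrete.
Variables (R : realType) (N : nat) (N3 : (3 <= N)%N) (k l : 'Z_N -> nat).
Hypotheses (k_gt0 : forall n, (0 < k n)%N) (l_gt0 : forall n, (0 < l n)%N).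
Hypothesis balanced :
  forall n : 'Z_N, (k (n - 1)%R * k (n + 1)%R = l (n - 1)%R * l (n + 1)%R)%N.
Variables (p : nat) (p_suitable : suitable k l p).
Local Notation K := (Kfield R k l).
Local Notation L := (Lfield R k l).
Local Notation a := (aroot R k l).
Local Notation mon := (@monomial R N k l p).
Local Notation isnode := (is_node k l).
Local Notation istau := (is_tau k l).

Lemma arootE n i (ni : isnode n i) :
  a n i = tofrac 'X_(enum_rank (SeqSub ni : node k l)).
Proof. by rewrite /aroot insubT. Qed.

Lemma aroot_neq0 n i : isnode n i -> a n i != 0.
Proof. by move=> ni; rewrite (arootE ni) tofracX_neq0. Qed.

Lemma tauE n i : tau R k l n i = tofrac (tau_poly k l K n i).
Proof. by rewrite /tau /tau_poly; case: insub => [x|] //; rewrite tofrac0. Qed.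

Definition KtoL_morphism : {rmorphism K -> L} :=
  (@tofrac {mpoly K[#|tau_index k l|]}) \o (@mpolyC #|tau_index k l| K).

Lemma KtoLE x : KtoL x = KtoL_morphism x. Proof. by []. Qed.

Lemma monomialE e : mon e = root_monomial a p e. Proof. by []. Qed.

Lemma K_rmorph_ext (S : fieldType) (f g : {rmorphism K -> S}) :
    (forall c, f (CtoK k l c) = g (CtoK k l c)) ->
    (forall n i, isnode n i -> f (a n i) = g (a n i)) -> f =1 g.
Proof.
move=> fgC fga; apply: fraction_rmorph_ext => q.
pose T := @tofrac {mpoly R[i][#|node k l|]}.
have : f \o T =1 g \o T.
  apply: mpoly_rmorph_ext => [c|i]; first exact: fgC.
  rewrite -(enum_valK i); case: (enum_val i) => -[n j] nj.
  by have := fga n j nj; rewrite (arootE nj).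
by apply.
Qed.

Lemma L_rmorph_ext (S : fieldType) (f g : {rmorphism L -> S}) :
    (forall c, f (KtoL (CtoK k l c)) = g (KtoL (CtoK k l c))) ->
    (forall n i, isnode n i -> f (KtoL (a n i)) = g (KtoL (a n i))) ->
    (forall n i, istau n i -> f (tau R k l n i) = g (tau R k l n i)) ->
  f =1 g.
Proof.
move=> fgC fga fgt; apply: fraction_rmorph_ext => q.
pose T := @tofrac {mpoly K[#|tau_index k l|]}.
have : f \o T =1 g \o T.
  apply: mpoly_rmorph_ext => [c|i].
    have : f \o KtoL_morphism =1 g \o KtoL_morphism by apply: K_rmorph_ext.
    by apply.
  have [m [j [mj ->]]] := tau_indexP i.
  by have := fgt m j mj; rewrite tauE (tau_polyE K mj).
by apply.
Qed.

Lemma adjacent_irrefl (x : 'Z_N * int) : adjacent x x = false.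
Proof.
rewrite /adjacent orbb /arrow eqxx [x.1 == _]eq_sym Zp_neq_succ // !andbF orbF.
by apply/eqP; lia.
Qed.

Lemma s_arootE n i m j : isnode n i -> isnode m j ->
  s_aroot R k l n i m j = a m j * a n i ^ cartan (n, i) (m, j).
Proof.
move=> ni mj; have ani := aroot_neq0 ni.
rewrite /s_aroot /cartan; case: eqP => [[-> ->]|_].
  by rewrite -{2}[a n i]expr1z -expfzDr.
by case: ifP => _; rewrite ?expr1z ?expr0z ?mulr1 // mulrC.
Qed.

Lemma K_reflection_exists n i : isnode n i ->
  exists sigma : {rmorphism K -> K},
    (forall c, sigma (CtoK k l c) = CtoK k l c) /\
    (forall m j, isnode m j -> sigma (a m j) = s_aroot R k l n i m j).
Proof.
move=> ni.
pose nb (r : 'I_#|node k l|) := adjacent (n, i) (ssval (enum_val r)).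
have nbx : ~~ nb (enum_rank (SeqSub ni : node k l)).
  by rewrite /nb enum_rankK adjacent_irrefl.
have [g [gC gX]] := reflection_substitution R[i] nbx.
exists g; split=> [c|m j mj]; first exact: gC.
rewrite (arootE mj) gX /nb enum_rankK (inj_eq enum_rank_inj) /s_aroot.
by rewrite -(inj_eq val_inj) /= -(arootE ni) -(arootE mj).
Qed.

Lemma K_reflection_monomial n i (sigma : {rmorphism K -> K}) e :
    isnode n i -> p_integral p e ->
    (forall m j, isnode m j -> sigma (a m j) = s_aroot R k l n i m j) ->
  sigma (mon e) = mon (reflection (n, i) e).
Proof.
move=> ni pe sa; apply: (root_monomial_reflection aroot_neq0 ni pe) => m j mj.
by rewrite sa // s_arootE.
Qed.

Lemma K_reflection_involutive n i (sigma : {rmorphism K -> K}) :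
    isnode n i ->
    (forall c, sigma (CtoK k l c) = CtoK k l c) ->
    (forall m j, isnode m j -> sigma (a m j) = s_aroot R k l n i m j) ->
  involutive sigma.
Proof.
move=> ni sC sa; have ani := aroot_neq0 ni.
have san : sigma (a n i) = (a n i)^-1 by rewrite sa // /s_aroot eqxx.
have : sigma \o sigma =1 (idfun : {rmorphism K -> K}).
  apply: K_rmorph_ext => [c|m j mj] /=; first by rewrite !sC.
  rewrite sa // s_arootE // rmorphM sa // s_arootE // fmorphXz san.
  by rewrite -mulrA -expfzMl divff // exp1rz mulr1.
by [].
Qed.

Definition monomialL (e : expo k l) : L := KtoL (mon e).

Local Notation M := monomialL.
Local Notation t := (tau R k l).

Lemma s_tau_center b n :
  s_tau R k l p n 0 n (signb b) = exchange_numer M t b n / t n (signb (~~ b)).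
Proof.
have [v1 v2 u1 u2] := exchange_exp_omega k_gt0 balanced n.
have crossE c : cross_product k l t c n =
    if c then xi R k l (n + 1) * Defs.eta R k l (n - 1)
    else xi R k l (n - 1) * Defs.eta R k l (n + 1).
  by case: c => //; apply: mulrC.
rewrite /exchange_numer !crossE !mulrA /s_tau eqxx.
by case: b; rewrite /= ?v1 ?v2 ?u1 ?u2.
Qed.

Lemma s_tau_fix n m (j : int) : (m != n) || (j != 1) && (j != -1) ->
  s_tau R k l p n 0 m j = t m j.
Proof.
rewrite /s_tau eqxx; have [->|//] := eqVneq m n.
by move=> /= /andP[/negPf-> /negPf->].
Qed.

Lemma s_tau_leg n (i : int) m (j : int) : i != 0 ->
  s_tau R k l p n i m j = if m == n then t n (swap i j) else t m j.
Proof.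
move=> /negPf i0; rewrite /s_tau i0 /swap; have [->|//] := eqVneq m n.
by rewrite /=; do !case: ifP.
Qed.

Lemma induced_by_exists n i : isnode n i ->
  exists f : {rmorphism L -> L}, induced_by p n i f.
Proof.
move=> ni; have [sigma [sC sa]] := K_reflection_exists ni.
have sK := K_reflection_involutive ni sC sa.
have sM := fun e pe => @K_reflection_monomial n i sigma e ni pe sa.
have [i0|i0] := eqVneq i 0; last first.
  have [g [gK gt]] := swap_automorphism k_gt0 l_gt0 sK ni i0.
  exists g; split=> [c|m j mj|m j mj].
  - by rewrite /KtoL gK sC.
  - by rewrite /KtoL gK sa.
  - by rewrite tauE gt // s_tau_leg // -tauE; case: eqP => // ->.
subst i; have mon0 e : mon e != 0.
  apply/prodf_neq0 => x _; apply: expfz_neq0.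
  by apply: aroot_neq0; rewrite /is_node -surjective_pairing (valP x).
have sE c b : sigma (mon (exchange_exp k l c b n)) = mon (exchange_exp k l c (~~ b) n).
  by rewrite sM ?exchange_exp_flip //; apply: p_integral_exchange_exp.
have [g [gK gc gf]] :=
  exchange_automorphism k_gt0 l_gt0 sK N3 (n := n) (mono := mon) (fun b => mon0 _) sE.
exists g; split=> [c|m j mj|m j mj].
- by rewrite /KtoL gK sC.
- by rewrite /KtoL gK sa.
have [[-> [b ->]]|far] := center_or_fixed n mj; last first.
  by rewrite s_tau_fix // tauE gf.
rewrite s_tau_center !tauE gc; congr (_ / _).
have -> : t = fun m j => tofrac (tau_poly k l K m j).
  by do 2!apply: funext => ?; apply: tauE.
exact: (rmorph_exchange_numer (@tofrac _)).
Qed.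

Lemma KtoL_monomial e : M e = root_monomial (fun m j => KtoL (a m j)) p e.
Proof.
rewrite /monomialL monomialE KtoLE /root_monomial rmorph_prod; apply: eq_bigr => x _.
exact: fmorphXz.
Qed.

Lemma KtoL_aroot_neq0 n i : isnode n i -> KtoL (a n i) != 0.
Proof. by move=> ni; rewrite KtoLE fmorph_eq0 aroot_neq0. Qed.

Lemma induced_by_monomial n i (f : {rmorphism L -> L}) e :
  isnode n i -> p_integral p e -> induced_by p n i f ->
  f (M e) = M (reflection (n, i) e).
Proof.
move=> ni pe [_ fa _]; rewrite !KtoL_monomial.
apply: (root_monomial_reflection KtoL_aroot_neq0 ni pe) => m j mj.
rewrite fa // s_arootE // !KtoLE rmorphM; congr (_ * _).
exact: fmorphXz.
Qed.

(** The p-th root of a_n^i is a monomial, with exponent 1/p at the vertex (n,i), so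
    the relations on the roots are those on exponent vectors. *)
Lemma aroot_monomial n i : isnode n i ->
  exists2 e, p_integral p e & KtoL (a n i) = M e.
Proof.
have [p_gt0 _] := p_suitable; have p0 : p%:R != 0 :> rat by rewrite pnatr_eq0 -lt0n.
move=> ni; exists (p%:R^-1 *: aexp k l n i).
  by move=> x; rewrite expoZE ffunE mulrA divff // mul1r natr_int.
by rewrite /monomialL monomialE root_monomial_aexp // divff // numq_int.
Qed.

Lemma induced_by_unique n i (f g : {rmorphism L -> L}) :
  induced_by p n i f -> induced_by p n i g -> f =1 g.
Proof.
move=> [fC fa ft] [gC ga gt]; apply: L_rmorph_ext => [c|m j mj|m j mj].
- by rewrite fC gC.
- by rewrite fa ?ga.
- by rewrite ft ?gt.
Qed.

Section Relations.
Variable s : 'Z_N -> int -> {rmorphism L -> L}.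
Hypothesis sP : forall n i, isnode n i -> induced_by p n i (s n i).

Let sC n i c : isnode n i -> s n i (KtoL (CtoK k l c)) = KtoL (CtoK k l c).
Proof. by case/sP. Qed.

Let sM n i e : isnode n i -> p_integral p e -> s n i (M e) = M (reflection (n, i) e).
Proof. by move=> ni pe; apply: induced_by_monomial => //; apply: sP. Qed.

Let MD e1 e2 : p_integral p e1 -> p_integral p e2 -> M (e1 + e2) = M e1 * M e2.
Proof. by move=> p1 p2; rewrite !KtoL_monomial (root_monomialD KtoL_aroot_neq0). Qed.

Let t_neq0 n j : istau n j -> t n j != 0.
Proof. by move=> nj; rewrite tauE (tau_polyE K nj) tofracX_neq0. Qed.

Let s_leg n i m j : isnode n i -> i != 0 -> istau m j ->
  s n i (t m j) = if m == n then t n (swap i j) else t m j.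
Proof. by move=> ni i0 mj; have [_ _ ->] := sP ni; rewrite ?s_tau_leg. Qed.

Let s_numer n b : s n 0 (t n (signb b)) = exchange_numer M t b n / t n (signb (~~ b)).
Proof.
have [_ _ ->] := sP (node0 k_gt0 l_gt0 n); first exact: s_tau_center.
exact: tau_signb.
Qed.

Let s_fix n m j : istau m j -> (m != n) || (j != 1) && (j != -1) ->
  s n 0 (t m j) = t m j.
Proof.
move=> mj far; have [_ _ ->] := sP (node0 k_gt0 l_gt0 n) => //.
exact: s_tau_fix.
Qed.

Lemma simple_reflection_involutive n i : isnode n i -> s n i \o s n i =1 id.
Proof.
move=> ni; apply: (@L_rmorph_ext L (s n i \o s n i) idfun) => [c|m j mj|m j mj] /=.
- by rewrite !sC.
- have [e pe ->] := aroot_monomial mj.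
  rewrite !sM ?reflectionK //; exact: p_integral_reflection.
- exact: (s_t_involutive N3 k_gt0 l_gt0 balanced p_suitable t_neq0 sM s_leg s_numer s_fix).
Qed.

Lemma simple_reflection_comm n i m j : isnode n i -> isnode m j ->
    (n, i) != (m, j) -> ~~ adjacent (n, i) (m, j) ->
  s n i \o s m j =1 s m j \o s n i.
Proof.
move=> ni mj neq far.
apply: (@L_rmorph_ext L (s n i \o s m j) (s m j \o s n i)) => [c|m' j' mj'|m' j' mj'] /=.
- by rewrite !sC.
- have [e pe ->] := aroot_monomial mj'.
  rewrite !sM //; try exact: p_integral_reflection.
  by rewrite (reflection_comm (x := (n, i)) (y := (m, j))).
- exact: (s_t_comm N3 k_gt0 l_gt0 balanced p_suitable sM s_leg s_numer s_fix).
Qed.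

Lemma simple_reflection_braid n i m j : isnode n i -> isnode m j ->
    (n, i) != (m, j) -> adjacent (n, i) (m, j) ->
  s n i \o s m j \o s n i =1 s m j \o s n i \o s m j.
Proof.
move=> ni mj neq adj.
apply: (@L_rmorph_ext L (s n i \o s m j \o s n i) (s m j \o s n i \o s m j))
  => [c|m' j' mj'|m' j' mj'] /=.
- by rewrite !sC.
- have [e pe ->] := aroot_monomial mj'.
  rewrite !sM //; try by do ?apply: p_integral_reflection.
  by rewrite (reflection_braid (x := (n, i)) (y := (m, j))).
- exact: (s_t_braid N3 k_gt0 l_gt0 balanced p_suitable MD t_neq0 sM s_leg s_numer s_fix).
Qed.

Lemma simple_reflection_bijective n i : isnode n i -> bijective (s n i).
Proof. by move=> ni; exists (s n i); apply: simple_reflection_involutive. Qed.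

(** For two involutions, the relation of order 3 or 2 for their product is the
    braid or the commutation relation. *)
Lemma simple_reflections_weyl :
  weyl_relations k l (fun n i => s n i : L -> L).
Proof.
split=> [n i ni|n i m j ni mj neq]; first exact: simple_reflection_involutive.
have nK := simple_reflection_involutive ni; have mK := simple_reflection_involutive mj.
case: ifP => adj x /=.
  have br := simple_reflection_braid ni mj neq adj.
  move: (br (s m j x)) (mK x) (nK x) (nK (s m j x)) => /= b1 m1 n1 n2.
  rewrite b1 m1.
  by move: (mK (s n i x)) => /= ->.
have := simple_reflection_comm ni mj neq (negbT adj) (s n i (s m j x)) => /= ->.
by move: (nK (s m j x)) (mK x) => /= -> ->.
Qed.

End Relations.
End Concrete.

Theorem theorem3p1 (R : realType) (N : nat) (hN : (3 <= N)%N)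
    (k l : 'Z_N -> nat)
    (hk : forall n, (0 < k n)%N) (hl : forall n, (0 < l n)%N)
    (hkl : forall n : 'Z_N, (k (n - 1)%R * k (n + 1)%R = l (n - 1)%R * l (n + 1)%R)%N)
    (p : nat) (hp : suitable k l p) :
  exists s : 'Z_N -> int -> {rmorphism Lfield R k l -> Lfield R k l},
    [/\ forall n i, is_node k l n i -> induced_by p n i (s n i),
        forall n i (f : {rmorphism Lfield R k l -> Lfield R k l}),
          is_node k l n i -> induced_by p n i f -> f =1 s n i,
        forall n i, is_node k l n i -> bijective (s n i)
      & weyl_relations k l (fun n i => s n i : Lfield R k l -> Lfield R k l)].
Proof.
have /choice[s sP] (x : 'Z_N * int) : exists f : {rmorphism Lfield R k l -> Lfield R k l},
    is_node k l x.1 x.2 -> induced_by p x.1 x.2 f.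
  have [ni|_] := boolP (is_node k l x.1 x.2); last by exists idfun.
  by have [f fP] := induced_by_exists R hN hk hl hkl hp ni; exists f.
have s_induced n i : is_node k l n i -> induced_by p n i (s (n, i)) := sP (n, i).
exists (fun n i => s (n, i)); split=> [n i ni|n i f ni fP|n i ni|].
- exact: s_induced.
- exact: induced_by_unique fP (s_induced n i ni).
- exact: (simple_reflection_bijective hN hk hl hkl hp s_induced).
- exact: (simple_reflections_weyl hN hk hl hkl hp s_induced).
Qed.
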